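(* Let $r,J\geq 1$ be integers. Suppose $p_{1},\ldots,p_{J}$ are NC $*$-polynomials in infinitely many variables that are homogeneous in the set of the first $r$ variables, where $p_{j}$ has degree of homogeneity $d_{j}\geq 1$. Suppose $C_{1},\ldots,C_{J}>0$ are real constants. Let $A$ be any $C^{*}$-algebra, $I\vartriangleleft A$ an ideal, and $\pi:A\to A/I$ the quotient map. Given $x_{1},\ldots,x_{r}$ and $y_{1},y_{2},\ldots$ in $A$ with \[ \pi\left(x_{k}\right)\pi\left(x_{l}\right)=0\quad(k,l=1,\ldots,r) \] and \[ \left\Vert p_{j}\left(\pi(x_{1}),\ldots,\pi(x_{r}),\pi(y_{1}),\pi(y_{2}),\ldots\right)\right\Vert \leq C_{j}\quad(j=1,\ldots,J), \] there are $\bar{x}_{1},\ldots,\bar{x}_{r}$ in $A$ with $\pi(\bar{x}_{k})=\pi(x_{k})$ for $k=1,\ldots,r$, and \[ \bar{x}_{k}\bar{x}_{l}=0\quad(k,l=1,\ldots,r) \] and \[ \left\Vert p_{j}\left(\bar{x}_{1},\ldots,\bar{x}_{r},y_{1},y_{2},\ldots\right)\right\Vert \leq C_{j}\quad(j=1,\ldots,J). \]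
   Context: Ideals of $C^{*}$-algebras are closed and two-sided. An NC $*$-polynomial is a (complex) polynomial in noncommuting variables and their formal adjoints; ''in infinitely many variables'' means the variables come from an infinite sequence, each polynomial involving only finitely many of them. A $*$-polynomial is homogeneous of degree $d$ for (or in) some subset $S$ of the variables when, in each of its monomials, the total number of times either $x$ or $x^{*}$ with $x\in S$ appears (counted with multiplicity, summed over all $x\in S$) is exactly $d$. The variables outside $S$ may appear arbitrarily. *)

(* Defs.v *)
From HB Require Import structures.
From mathcomp Require Import all_boot all_order all_algebra.
From mathcomp Require Import generic_quotient ring_quotient.
From mathcomp Require Import finmap complex.
From mathcomp Require Import all_classical all_reals topology normedtype.
(* monalg is used without its notations, whose levels clash with those of
   mathcomp-analysis. *)
From mathcomp Require monalg.
Import (canonicals, coercions) monalg.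

Set Implicit Arguments.
Unset Strict Implicit.
Unset Printing Implicit Defensive.

Import Order.TTheory GRing.Theory Num.Theory.
Import numFieldNormedType.Exports.

Local Open Scope classical_set_scope.
Local Open Scope ring_scope.
Local Open Scope complex_scope.

(* A C^*-algebra need not have a unit, so the ring structures of MathComp,
   which are all unital, do not apply. The two operations are first declared
   without axioms, so that *-polynomials can be evaluated both in a C^*-algebra
   and in its quotients. *)
HB.mixin Record hasMulStar (R : realType) (A : Type) := {
  amul : A -> A -> A;
  star : A -> A
}.

#[short(type="mulStarType")]
HB.structure Definition MulStar (R : realType) :=
  {A of GRing.Lmodule R[i] A & hasMulStar R A}.

Arguments amul {R s} : rename.
Arguments star {R s} : rename.

Notation "a ** b" := (amul a b)
  (at level 40, left associativity) : ring_scope.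

HB.mixin Record isCStarAlgebra (R : realType) (A : Type)
    of CompleteNormedModule R[i] A & MulStar R A := {
  amulA : forall a b c : A, a ** (b ** c) = (a ** b) ** c;
  amulDl : forall a b c : A, (a + b) ** c = a ** c + b ** c;
  amulDr : forall a b c : A, a ** (b + c) = a ** b + a ** c;
  amulZl : forall (z : R[i]) (a b : A), (z *: a) ** b = z *: (a ** b);
  amulZr : forall (z : R[i]) (a b : A), a ** (z *: b) = z *: (a ** b);
  starK : forall a : A, star (star a) = a;
  starD : forall a b : A, star (a + b) = star a + star b;
  starZ : forall (z : R[i]) (a : A), star (z *: a) = conjc z *: star a;
  starM : forall a b : A, star (a ** b) = star b ** star a;
  amul_norm : forall a b : A, `|a ** b| <= `|a| * `|b|;
  cstar_norm : forall a : A, `|star a ** a| = `|a| ^+ 2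
}.

#[short(type="cstarAlgType")]
HB.structure Definition CStarAlgebra (R : realType) :=
  {A of CompleteNormedModule R[i] A & MulStar R A & isCStarAlgebra R A}.

(* The norm of a normed module over R[i] takes its values in R[i]; these are
   nonnegative reals, so no information is lost by taking the real part. *)
Definition cnorm (R : realType) (A : cstarAlgType R) (a : A) : R :=
  complex.Re `|a|.

Record closedIdeal (R : realType) (A : cstarAlgType R) := ClosedIdeal {
  ideal_set :> set A;
  ideal_closed : closed ideal_set;
  ideal0 : ideal_set 0;
  idealD : forall a b, ideal_set a -> ideal_set b -> ideal_set (a + b);
  idealZ : forall (z : R[i]) a, ideal_set a -> ideal_set (z *: a);
  idealMl : forall a b, ideal_set b -> ideal_set (a ** b);
  idealMr : forall a b, ideal_set a -> ideal_set (a ** b)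
}.

Section Quotient.
Local Open Scope quotient_scope.
Variables (R : realType) (A : cstarAlgType R) (I : closedIdeal A).

Definition ideal_pred : {pred A} := fun a => `[< ideal_set I a >].

Lemma ideal_predP a : reflect (ideal_set I a) (a \in ideal_pred).
Proof. exact: asboolP. Qed.

Lemma ideal_zmod_closed : zmod_closed ideal_pred.
Proof.
split; first by apply/ideal_predP; exact: ideal0.
move=> a b /ideal_predP Ia /ideal_predP Ib; apply/ideal_predP.
by apply: idealD => //; rewrite -scaleN1r; exact: idealZ.
Qed.

HB.instance Definition _ :=
  GRing.isZmodClosed.Build A ideal_pred ideal_zmod_closed.

Definition cquot := Quotient.quot ideal_pred.
HB.instance Definition _ := GRing.Zmodule.on cquot.

Definition cproj (a : A) : cquot := \pi_(Quotient.quot ideal_pred) a.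

Lemma cprojP a b : cproj a = cproj b <-> ideal_set I (a - b).
Proof.
split=> [/eqP|Iab]; first by rewrite -Quotient.idealrBE => /ideal_predP.
by apply/eqP; rewrite -Quotient.idealrBE; exact/ideal_predP.
Qed.

Lemma cproj_repr (q : cquot) : cproj (repr q) = q.
Proof. exact: reprK. Qed.

Lemma cprojD a b : cproj (a + b) = cproj a + cproj b.
Proof. by rewrite /cproj [LHS]Quotient.pi_add. Qed.

Definition qscale (z : R[i]) (q : cquot) : cquot := cproj (z *: repr q).

Lemma cprojZ z a : cproj (z *: a) = qscale z (cproj a).
Proof.
apply/cprojP; rewrite -scalerBr; apply: idealZ.
by apply/cprojP; rewrite cproj_repr.
Qed.

Lemma qscaleA z w q : qscale z (qscale w q) = qscale (z * w) q.
Proof. by rewrite -[q]cproj_repr -!cprojZ scalerA. Qed.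

Lemma qscale1 : left_id 1 qscale.
Proof. by move=> q; rewrite -[q in LHS]cproj_repr -cprojZ scale1r cproj_repr. Qed.

Lemma qscaleDr : right_distributive qscale +%R.
Proof.
move=> z p q; rewrite -[p]cproj_repr -[q]cproj_repr.
by rewrite -cprojD -!cprojZ -cprojD scalerDr.
Qed.

Lemma qscaleDl q : {morph qscale^~ q : z w / z + w}.
Proof. by move=> z w; rewrite -[q]cproj_repr -!cprojZ -cprojD scalerDl. Qed.

HB.instance Definition _ := GRing.Zmodule_isLmodule.Build R[i] cquot
  qscaleA qscale1 qscaleDr qscaleDl.

(* The operations of A/I are computed on chosen representatives. The product
   does not depend on them by cprojM below; neither does the adjoint, because
   closed two-sided ideals of C^*-algebras are self-adjoint. *)
HB.instance Definition _ := hasMulStar.Build R cquot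
  (fun p q => cproj (repr p ** repr q))
  (fun q => cproj (star (repr q))).

Lemma cprojM a b : cproj (a ** b) = cproj a ** cproj b.
Proof.
apply/cprojP; set a' := repr _; set b' := repr _.
have Ia : ideal_set I (a - a') by apply/cprojP; rewrite cproj_repr.
have Ib : ideal_set I (b - b') by apply/cprojP; rewrite cproj_repr.
have -> : a ** b - a' ** b' = (a - a') ** b + a' ** (b - b').
  rewrite amulDl amulDr -[- b']scaleN1r -[- a']scaleN1r amulZr amulZl !scaleN1r.
  by rewrite addrA subrK.
by apply: idealD; [exact: idealMr | exact: idealMl].
Qed.

Definition qnorm (q : cquot) : R :=
  reals.inf [set cnorm a | a in [set a | cproj a = q]].

End Quotient.

(* The free unital complex algebra on the letters (n, false), standing for the
   n-th variable, and (n, true), standing for its formal adjoint. *)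
Definition ncLetter : choiceType := (nat * bool)%type.
Definition ncMonomial : monalg.MonomialDef.type := monalg.fmonom ncLetter.
Definition ncPoly (R : realType) := monalg.malg ncMonomial R[i].

Definition homogeneous_in (R : realType) (S : pred nat) (d : nat)
    (p : ncPoly R) : Prop :=
  forall m : ncMonomial, m \in monalg.msupp p ->
    count (fun l : ncLetter => S l.1) (monalg.fmonom_val m) = d.

Section Evaluation.
Variables (R : realType) (B : mulStarType R) (v : nat -> B).

Definition eval_letter (l : ncLetter) : B :=
  if l.2 then star (v l.1) else v l.1.

(* The empty word has no value in an algebra without unit; it is sent to 0, and
   it does not occur in polynomials that are homogeneous of positive degree. *)
Fixpoint eval_word (w : seq ncLetter) : B :=
  match w with
  | [::] => 0
  | [:: l] => eval_letter l
  | l :: w' => eval_letter l ** eval_word w'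
  end.

Definition nceval (p : ncPoly R) : B :=
  \sum_(m <- monalg.msupp p)
    monalg.mcoeff m p *: eval_word (monalg.fmonom_val m).

End Evaluation.

Definition join_vars (B : Type) (r : nat) (x : 'I_r -> B) (y : nat -> B) :
    nat -> B :=
  fun n => if insub n is Some k then x k else y (n - r)%N.

(* Main.v *)
Require Import Defs.
From HB Require Import structures.
From mathcomp Require Import all_boot all_order all_algebra.
From mathcomp Require Import finmap complex.
From mathcomp Require Import all_classical all_reals topology normedtype.
From mathcomp Require Import ring lra.
From mathcomp Require monalg.
Import (canonicals, coercions) monalg.

(** The unit of the algebra is the first thing to secure: [A] is embedded in its
    unitization, which is again a C-star-algebra, so that one may multiply by
    elements [1 - u] with [u] in the ideal [I], which does not change classes
    modulo [I].

    The lift is the limit of a sequence of corrections [X] of [x], all congruent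
    to [x] modulo [I]. The defect of [X] is measured by the norms of the products
    [X k * X l], which lie in [I], and by the excess of the norms of the
    [p j (X, y)] over [C j]. A correction shrinks the defect while moving [X] by
    a summable amount; it has two halves, both driven by an element [u] of [I],
    [0 <= u <= 1], that almost commutes with finitely many given elements and
    almost acts as a unit on finitely many given elements of [I]
    ([quasicentral_unit]).

    Products ([product_step]). Let [h] be a multiple of the sum of the
    [adj (X k) * X k] with [0 <= h <= 1], and put [s = (1 - h) ^+ m]. Replace
    [X k] by [s ^+ q * X k * (1 - u * s)]. The left factor only changes [X k] by
    an element of [I], and by little, because [h * X k] is a combination of the
    products [X l * X k]. The right factor changes [X k] by little because
    [adj (X k) * X k] is dominated by a multiple of [h], so that [X k * s] has norm
    of order [1 / sqrt m]. In a new product, the inner factor [1 - u * s] is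
    [(1 - u) + u * (1 - s)]: the first term almost kills what lies in [I], and the
    second one meets [s ^+ q], with [(1 - s) * s ^+ q] of norm at most
    [1 / (q + 1)]. Hence the products shrink by any prescribed factor.

    Norms ([norm_adjuster]). Put [c = 1 - u], let [s] be a square root of
    [1 - c * c], and let [v = c * c + (1 - d) * s * s]. If [Q'] is any lift of the
    class of [Q] modulo [I], then [v * Q] is close to
    [c * Q' * c + (1 - d) * s * Q * s], whose norm is at most the maximum of the
    norms of [Q'] and of [(1 - d) * Q] ([nrm_compression]). By homogeneity
    [p j (v * X, y)] is close to [v ^+ d j * p j (X, y)]; a [d] proportional to
    the excess therefore brings all norms down to [C j] up to an error as small
    as desired.

    With [t = 2 ^ -n], the two halves turn the bounds [t ^+ 3] for the products and
    [t] for the excess into the same bounds for [t / 2], and move [X] by [O(t)]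
    ([combined_step]); so the corrections converge ([nilpotent_lifting]).

    The C-star-theory that this needs is derived from the axioms by elementary
    means: square roots by an iteration that only involves norms, positivity
    through the condition that [t - a] has norm at most [t], and positivity of
    [adj a * a] by the argument of Kelley and Vaught. *)

Set Implicit Arguments.
Unset Strict Implicit.
Unset Printing Implicit Defensive.

Import Order.TTheory GRing.Theory Num.Theory.
Import numFieldNormedType.Exports.
Local Open Scope ring_scope.
Local Open Scope complex_scope.

(** * Identities in noncommutative rings *)

Section NcRing.
Variable R : pzRingType.

(** Reflection of ring expressions: an identity that uses no commutation is
    checked by expanding both sides into integer combinations of words. *)
Inductive ncexpr :=
  | NcVar of nat | NcZero | NcOne | NcAdd of ncexpr & ncexpr
  | NcOpp of ncexpr | NcMul of ncexpr & ncexpr | NcMuln of ncexpr & nat.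

Fixpoint nc_eval (env : seq R) e : R :=
  match e with
  | NcVar i => env`_i
  | NcZero => 0
  | NcOne => 1
  | NcAdd a b => nc_eval env a + nc_eval env b
  | NcOpp a => - nc_eval env a
  | NcMul a b => nc_eval env a * nc_eval env b
  | NcMuln a n => nc_eval env a *+ n
  end.

Definition ncpoly := seq (seq nat * int).

Fixpoint nc_insert (m : seq nat * int) (p : ncpoly) : ncpoly :=
  if p is w :: p' then
    if w.1 == m.1 then (w.1, w.2 + m.2) :: p' else w :: nc_insert m p'
  else [:: m].

Fixpoint nc_norm e : ncpoly :=
  match e with
  | NcVar i => [:: ([:: i], 1)]
  | NcZero => [::]
  | NcOne => [:: ([::], 1)]
  | NcAdd a b => foldr nc_insert (nc_norm b) (nc_norm a)
  | NcOpp a => [seq (m.1, - m.2) | m <- nc_norm a]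
  | NcMul a b => foldr nc_insert [::]
      [seq (m.1 ++ w.1, m.2 * w.2) | m <- nc_norm a, w <- nc_norm b]
  | NcMuln a n => [seq (m.1, m.2 * n%:Z) | m <- nc_norm a]
  end.

Definition nc_meval (env : seq R) (m : seq nat * int) : R :=
  (\prod_(i <- m.1) env`_i) *~ m.2.

Definition nc_peval env (p : ncpoly) : R := \sum_(m <- p) nc_meval env m.

Lemma nc_insertE env m p :
  nc_peval env (nc_insert m p) = nc_meval env m + nc_peval env p.
Proof.
elim: p => [|w p IH] /=; rewrite /nc_peval !big_cons ?big_nil //.
case: eqP => [e|_]; rewrite big_cons; last first.
  by rewrite -/(nc_peval _ _) IH addrCA.
by rewrite addrA /nc_meval /= e -mulrzDr [w.2 + _]addrC.
Qed.

Lemma nc_foldrE env p q :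
  nc_peval env (foldr nc_insert q p) = nc_peval env p + nc_peval env q.
Proof.
elim: p => [|m p IH] /=; first by rewrite {2}/nc_peval big_nil add0r.
by rewrite nc_insertE IH [nc_peval _ (m :: p)]big_cons addrA.
Qed.

Lemma nc_normE env e : nc_peval env (nc_norm e) = nc_eval env e.
Proof.
elim: e => /= [i|||a <- b <-|a <-|a <- b <-|a <- n].
- by rewrite /nc_peval big_seq1 /nc_meval /= big_seq1.
- by rewrite /nc_peval big_nil.
- by rewrite /nc_peval big_seq1 /nc_meval /= big_nil.
- exact: nc_foldrE.
- rewrite /nc_peval big_map -sumrN; apply: eq_bigr => m _.
  by rewrite /nc_meval /= mulrNz.
- rewrite nc_foldrE [nc_peval _ [::]]big_nil addr0 /nc_peval big_allpairs_dep.
  rewrite mulr_suml; apply: eq_bigr => m _; rewrite mulr_sumr.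
  apply: eq_bigr => w _; rewrite /nc_meval /= big_cat /=.
  by rewrite mulrzAl mulrzAr mulrzA_C.
- rewrite /nc_peval big_map -sumrMnl; apply: eq_bigr => m _.
  by rewrite /nc_meval /= mulrzA.
Qed.

Lemma nc_ring_correct env a b :
  all (fun m => m.2 == 0) (nc_norm (NcAdd a (NcOpp b))) ->
  nc_eval env a = nc_eval env b.
Proof.
move=> h; apply/eqP; rewrite -subr_eq0 -[_ - _]/(nc_eval env (NcAdd a (NcOpp b))).
rewrite -nc_normE /nc_peval big_seq big1 // => m /(allP h) /eqP.
by rewrite /nc_meval => ->.
Qed.

End NcRing.

Ltac nc_find x l :=
  lazymatch l with
  | x :: _ => constr:(0%N)
  | _ :: ?l' => let n := nc_find x l' in constr:(n.+1)
  end.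

Ltac nc_atoms t l :=
  lazymatch t with
  | (?a + ?b)%R => let l := nc_atoms a l in nc_atoms b l
  | (?a * ?b)%R => let l := nc_atoms a l in nc_atoms b l
  | (- ?a)%R => nc_atoms a l
  | (?a *+ _)%R => nc_atoms a l
  | 0%R => l
  | 1%R => l
  | _ => match l with
         | _ => let _ := nc_find t l in l
         | _ => constr:(t :: l)
         end
  end.

Ltac nc_reify t l :=
  lazymatch t with
  | (?a + ?b)%R => let a := nc_reify a l in let b := nc_reify b l in
                   constr:(NcAdd a b)
  | (?a * ?b)%R => let a := nc_reify a l in let b := nc_reify b l in
                   constr:(NcMul a b)
  | (- ?a)%R => let a := nc_reify a l in constr:(NcOpp a)
  | (?a *+ ?n)%R => let a := nc_reify a l in constr:(NcMuln a n)
  | 0%R => constr:(NcZero)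
  | 1%R => constr:(NcOne)
  | _ => let n := nc_find t l in constr:(NcVar n)
  end.

(** Atoms are compared syntactically, so instances of the same term that are
    only convertible must be generalized beforehand. *)
Ltac ncring :=
  lazymatch goal with
  | |- @eq ?T ?a ?b =>
    let l := nc_atoms a (@nil T) in
    let l := nc_atoms b l in
    let a' := nc_reify a l in
    let b' := nc_reify b l in
    apply: (@nc_ring_correct _ l a' b'); vm_compute; reflexivity
  end.


(** * Unital C-star-algebras *)

(** Norms are real-valued and completeness is stated with sequences, since only
    estimates are needed. The inequality [nrm_cstar_le] is the half of the
    C-star-identity that implies the other one. *)
HB.mixin Record isUnitalCStar (R : realType) B of GRing.Algebra R[i] B := {
  adj : B -> B;
  nrm : B -> R;
  adjD : forall a b, adj (a + b) = adj a + adj b;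
  adjZ : forall (z : R[i]) a, adj (z *: a) = conjc z *: adj a;
  adjM : forall a b, adj (a * b) = adj b * adj a;
  adjK : forall a, adj (adj a) = a;
  nrm0_eq0 : forall a, nrm a = 0 -> a = 0;
  ler_nrmD : forall a b, nrm (a + b) <= nrm a + nrm b;
  nrmZ : forall (z : R[i]) a, nrm (z *: a) = complex.Re `|z| * nrm a;
  ler_nrmM : forall a b, nrm (a * b) <= nrm a * nrm b;
  nrm_cstar_le : forall a, nrm a ^+ 2 <= nrm (adj a * a);
  nrm_complete : forall u : nat -> B,
    (forall e, 0 < e -> exists N, forall m n, (N <= m)%N -> (N <= n)%N ->
       nrm (u m - u n) <= e) ->
    exists l, forall e, 0 < e -> exists N, forall n, (N <= n)%N ->
       nrm (u n - l) <= e
}.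

#[short(type="ucstarType")]
HB.structure Definition UnitalCStar (R : realType) :=
  {B of GRing.Algebra R[i] B & isUnitalCStar R B}.

Section Norm.
Variables (R : realType) (B : ucstarType R).
Implicit Types (a b c : B) (t : R).

Lemma Re_norm_real t : complex.Re `|t%:C| = `|t|.
Proof. by rewrite normc_def /= expr0n addr0 sqrtr_sqr. Qed.

Lemma nrmZr t a : nrm (t%:C *: a) = `|t| * nrm a.
Proof. by rewrite nrmZ Re_norm_real. Qed.

Lemma scaler_natC n a : n%:R%:C *: a = a *+ n.
Proof. by rewrite rmorph_nat scaler_nat. Qed.

Lemma nrm0 : nrm (0 : B) = 0.
Proof. by rewrite -(scale0r (0 : B)) nrmZ normr0 mul0r. Qed.

Lemma nrmN a : nrm (- a) = nrm a.
Proof. by rewrite -scaleN1r nrmZ normrN normr1 mul1r. Qed.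

Lemma nrm_ge0 a : 0 <= nrm a.
Proof.
have := ler_nrmD a (- a); rewrite subrr nrm0 nrmN -mulr2n.
by rewrite pmulrn_lge0.
Qed.

Lemma nrmB a b : nrm (a - b) = nrm (b - a).
Proof. by rewrite -nrmN opprB. Qed.

Lemma ler_nrmB a b : nrm (a - b) <= nrm a + nrm b.
Proof. by rewrite -(nrmN b) ler_nrmD. Qed.

Lemma ler_nrm_trans b a c x y :
  nrm (a - b) <= x -> nrm (b - c) <= y -> nrm (a - c) <= x + y.
Proof.
by move=> ? ?; rewrite -(subrKA b) (le_trans (ler_nrmD _ _)) ?lerD.
Qed.

Lemma ler_nrmDD a b x y : nrm a <= x -> nrm b <= y -> nrm (a + b) <= x + y.
Proof. by move=> ? ?; rewrite (le_trans (ler_nrmD _ _)) ?lerD. Qed.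

Lemma ler_nrmBD a b x y : nrm a <= x -> nrm b <= y -> nrm (a - b) <= x + y.
Proof. by move=> ? ?; rewrite (le_trans (ler_nrmB _ _)) ?lerD. Qed.

Lemma ler_nrmMM a b x y : nrm a <= x -> nrm b <= y -> nrm (a * b) <= x * y.
Proof.
by move=> ? ?; rewrite (le_trans (ler_nrmM _ _)) ?ler_pM ?nrm_ge0.
Qed.

Lemma adj_one : adj (1 : B) = 1.
Proof. by have := adjM (adj 1) (1 : B); rewrite mulr1 adjK mulr1. Qed.

Lemma adjZr t a : adj (t%:C *: a) = t%:C *: adj a.
Proof. by rewrite adjZ conjc_real. Qed.

Lemma adj0 : adj (0 : B) = 0.
Proof. by have := adjZ 0 (0 : B); rewrite scale0r conjc0 scale0r. Qed.

Lemma adjN a : adj (- a) = - adj a.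
Proof. by apply/eqP; rewrite -addr_eq0 -adjD addNr adj0. Qed.

Lemma adjB a b : adj (a - b) = adj a - adj b.
Proof. by rewrite adjD adjN. Qed.

Lemma adjX a n : adj (a ^+ n) = adj a ^+ n.
Proof. by elim: n => [|n IH]; rewrite ?adj_one // exprS exprSr adjM IH. Qed.

Lemma ler_nrm_sum I (s : seq I) (P : pred I) (F : I -> B) :
  nrm (\sum_(i <- s | P i) F i) <= \sum_(i <- s | P i) nrm (F i).
Proof.
elim/big_rec2: _ => [|i x y _ h]; first by rewrite nrm0.
exact: (ler_nrmDD (lexx _) h).
Qed.

Lemma nrm_adj a : nrm (adj a) = nrm a.
Proof.
suff le b : nrm b <= nrm (adj b).
  by apply/le_anti; rewrite le andbT -{2}(adjK a) le.
have := le_trans (nrm_cstar_le b) (ler_nrmM _ _); rewrite expr2.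
have := nrm_ge0 b; rewrite le0r => /orP[/eqP ->|b0]; first by rewrite nrm_ge0.
by rewrite ler_pM2r.
Qed.

Lemma nrm_cstar a : nrm (adj a * a) = nrm a ^+ 2.
Proof.
apply/le_anti; rewrite nrm_cstar_le andbT expr2.
by rewrite (le_trans (ler_nrmM _ _)) ?nrm_adj.
Qed.

Lemma nrm_cstar' a : nrm (a * adj a) = nrm a ^+ 2.
Proof. by rewrite -[a in a * _]adjK nrm_cstar nrm_adj. Qed.

Lemma nrm1_le1 : nrm (1 : B) <= 1.
Proof.
have := nrm_cstar_le (1 : B); rewrite adj_one mul1r expr2.
have := nrm_ge0 (1 : B); rewrite le0r => /orP[/eqP -> //|b0].
by rewrite -[X in _ <= X -> _]mul1r ler_pM2r.
Qed.

Lemma nrm_scalar_le t : 0 <= t -> nrm (t%:C *: (1 : B)) <= t.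
Proof.
by move=> t0; rewrite nrmZr ger0_norm // -[leRHS]mulr1 ler_wpM2l ?nrm1_le1.
Qed.

Lemma ler_nrmX a n : nrm a <= 1 -> nrm (a ^+ n) <= 1.
Proof.
move=> a1; elim: n => [|n IH]; first exact: nrm1_le1.
by rewrite exprS -[leRHS]mulr1 ler_nrmMM.
Qed.

Lemma nrm_sqr_sa a : adj a = a -> nrm (a * a) = nrm a ^+ 2.
Proof. by move=> sa; rewrite -{1}sa nrm_cstar. Qed.

Lemma nrm_le_eps a b : (forall e, 0 < e -> nrm (a - b) <= e) -> a = b.
Proof.
move=> h; apply/eqP; rewrite -subr_eq0; apply/eqP/nrm0_eq0.
by apply/le_anti; rewrite nrm_ge0 andbT; apply/ler_addgt0Pl => e /h; rewrite addr0.
Qed.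

(** Almost-commutation is expressed by the norm of the commutator; the lemmas
    below are its derivation rules. *)
Definition commut (a b : B) := a * b - b * a.

Lemma commutM a b c : commut (a * b) c = a * commut b c + commut a c * b.
Proof.
by rewrite /commut mulrBr mulrBl !mulrA subrKA.
Qed.

Lemma commutD a b c : commut (a + b) c = commut a c + commut b c.
Proof. by rewrite /commut mulrDl mulrDr opprD addrACA. Qed.

Lemma commutN a c : commut (- a) c = - commut a c.
Proof. by rewrite /commut mulNr mulrN opprD. Qed.

Lemma commutZ z a c : commut (z *: a) c = z *: commut a c.
Proof. by rewrite /commut -scalerAl -scalerAr scalerBr. Qed.

Lemma commut1 c : commut 1 c = 0.
Proof. by rewrite /commut mul1r mulr1 subrr. Qed.

Lemma nrm_commutM a b c x y k l : nrm a <= x -> nrm b <= y ->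
  nrm (commut a c) <= k -> nrm (commut b c) <= l ->
  nrm (commut (a * b) c) <= x * l + k * y.
Proof. by move=> *; rewrite commutM ler_nrmDD // ler_nrmMM. Qed.

Lemma nrm_commut_le a b x y : nrm a <= x -> nrm b <= y ->
  nrm (commut a b) <= 2 * (x * y).
Proof.
move=> ax by_; rewrite mulr_natl mulr2n ler_nrmBD //; first exact: ler_nrmMM.
by rewrite [x * y]mulrC ler_nrmMM.
Qed.

End Norm.

(** * Square roots *)

Lemma exists_inv_le (R : realType) (K e : R) :
  0 < e -> exists n, forall m, (n <= m)%N -> K / m.+1%:R <= e.
Proof.
move=> e0; exists (Num.bound (`|K| / e)) => m nm.
rewrite ler_pdivrMr ?ltr0Sn // mulrC -ler_pdivrMr //.
apply: (@le_trans _ _ (`|K| / e)); first by rewrite ler_pM2r ?invr_gt0 ?ler_norm.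
apply: ltW; apply: lt_le_trans (archi_boundP _) _; first by rewrite divr_ge0 ?normr_ge0 ?(ltW e0).
by rewrite ler_nat (leq_trans nm).
Qed.

Section SquareRoot.
Variables (R : realType) (B : ucstarType R).
Implicit Types (a b c x : B) (t : R).

Lemma nrm_le_inv K a b : (forall n : nat, nrm (a - b) <= K / n.+1%:R) -> a = b.
Proof.
move=> h; apply: nrm_le_eps => e /(exists_inv_le K)[n hn].
exact: le_trans (h n) (hn n (leqnn n)).
Qed.

(** If [y = (x + y * y) / 2] then [(1 - y) ^+ 2 = 1 - x]; this is the fixed point
    iteration for [y]. All its steps are polynomials in [x] with nonnegative
    coefficients, so for [x] in the unit ball it is controlled by the same
    iteration at [x = 1], which is [sqrt_bound]. *)
Fixpoint sqrt_iter x n : B :=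
  if n is n'.+1 then 2^-1%:C *: (x + sqrt_iter x n' * sqrt_iter x n') else 0.

Fixpoint sqrt_bound n : R :=
  if n is n'.+1 then 2^-1 * (1 + sqrt_bound n' * sqrt_bound n') else 0.

(** The iteration at [1] increases to [1] at speed [2 / n], which replaces the
    summability of the binomial coefficients of the square root. *)
Lemma sqrt_bound_ge n : 1 - 2 / n.+2%:R <= sqrt_bound n <= 1.
Proof.
elim: n => [|n /andP[lo hi]] /=; first by rewrite divff ?pnatr_eq0 // subrr lexx ler01.
have lo0 : 0 <= 1 - 2 / n.+2%:R :> R.
  by rewrite subr_ge0 ler_pdivrMr ?ltr0Sn // mul1r ler_nat.
have t0 := le_trans lo0 lo.
apply/andP; split; last first.
  by have := ler_pM t0 t0 hi hi; rewrite mulr1; lra.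
have sq : (1 - 2 / n.+2%:R) * (1 - 2 / n.+2%:R) <=
          sqrt_bound n * sqrt_bound n by apply: ler_pM.
suff : 1 - 2 / n.+3%:R <=
    2^-1 * (1 + (1 - 2 / n.+2%:R) * (1 - 2 / n.+2%:R)) :> R.
  by move=> h; apply: le_trans h _; rewrite ler_pM2l ?invr_gt0 // lerD2l.
have m0 : 0 < n.+2%:R :> R by rewrite ltr0Sn.
rewrite -(natr1 n.+2); set m := n.+2%:R in m0 *.
rewrite -subr_ge0.
have -> : 2^-1 * (1 + (1 - 2 / m) * (1 - 2 / m)) - (1 - 2 / (m + 1)) =
   2 / (m ^+ 2 * (m + 1)).
  by field; rewrite ?gt_eqF //=; lra.
by rewrite divr_ge0 // mulr_ge0 ?exprn_ge0; lra.
Qed.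

Lemma sqrt_iter_adj x n : adj x = x -> adj (sqrt_iter x n) = sqrt_iter x n.
Proof.
by move=> sa; elim: n => [|n IH] /=; rewrite ?adj0 // adjZr adjD adjM IH sa.
Qed.

Lemma sqrt_iter_comm x m n :
  sqrt_iter x m * sqrt_iter x n = sqrt_iter x n * sqrt_iter x m.
Proof.
have key c k : GRing.comm c x -> GRing.comm c (sqrt_iter x k).
  move=> cx; elim: k => [|k IH] /=; first exact: commr0.
  by rewrite /GRing.comm -scalerAr -scalerAl; congr (_ *: _);
     apply: commrD => //; apply: commrM.
by apply: (key); apply: commr_sym; apply: key.
Qed.

Lemma nrm_half a : nrm (2^-1%:C *: a) = 2^-1 * nrm a.
Proof. by rewrite nrmZr ger0_norm // invr_ge0. Qed.

Lemma nrm_sqrt_iter x n : nrm x <= 1 -> nrm (sqrt_iter x n) <= sqrt_bound n.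
Proof.
move=> x1; elim: n => [|n IH] /=; first by rewrite nrm0.
by rewrite nrm_half ler_pM2l ?invr_gt0 // ler_nrmDD // ler_nrmMM.
Qed.

Lemma nrm_sqrt_iterB x m n : nrm x <= 1 -> (n <= m)%N ->
  nrm (sqrt_iter x m - sqrt_iter x n) <= sqrt_bound m - sqrt_bound n.
Proof.
move=> x1.
have step k : nrm (sqrt_iter x k.+1 - sqrt_iter x k) <=
              sqrt_bound k.+1 - sqrt_bound k.
  elim: k => [|k IH].
    by rewrite /= !subr0 !mulr0 !addr0 nrm_half ler_pM2l ?invr_gt0.
  set y := sqrt_iter x k.+1 in IH *; set z := sqrt_iter x k in IH *.
  set s := sqrt_bound k.+1 in IH *; set t := sqrt_bound k in IH *.
  have -> : sqrt_iter x k.+2 - y = 2^-1%:C *: ((y - z) * (y + z)).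
    rewrite /= -/y {3}/y /= -/z -scalerBr opprD addrACA subrr add0r.
    congr (_ *: _); rewrite mulrBl !mulrDr opprD addrA.
    rewrite (_ : z * y = y * z); last exact: (sqrt_iter_comm x k k.+1).
    by rewrite addrK.
  have -> : sqrt_bound k.+2 - s = 2^-1 * ((s - t) * (s + t)).
    have -> : sqrt_bound k.+2 = 2^-1 * (1 + s * s) by [].
    have : s = 2^-1 * (1 + t * t) by [].
    by clearbody s t => ->; field.
  rewrite nrm_half ler_pM2l ?invr_gt0 // ler_nrmMM //.
  by rewrite ler_nrmDD // nrm_sqrt_iter.
elim: m => [|m IH]; first by rewrite leqn0 => /eqP ->; rewrite !subrr nrm0.
rewrite leq_eqVlt => /orP[/eqP -> |/IH h]; first by rewrite !subrr nrm0.
by have := ler_nrm_trans (step m) h; rewrite addrA subrK.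
Qed.

Lemma nrm_commut_sqrt_iter x c k n : nrm x <= 1 -> nrm (commut x c) <= k ->
  nrm (commut (sqrt_iter x n) c) <= n%:R * k.
Proof.
move=> x1 xc; elim: n => [|n IH] /=.
  by rewrite /commut mul0r mulr0 subrr nrm0 mul0r.
have y1 : nrm (sqrt_iter x n) <= 1.
  by apply: le_trans (nrm_sqrt_iter _ x1) _; case/andP: (sqrt_bound_ge n).
rewrite commutZ nrm_half commutD.
have := ler_nrmDD xc (nrm_commutM y1 y1 IH IH).
by have := le_trans (nrm_ge0 _) xc; rewrite -[n.+1%:R]natr1; lra.
Qed.

(** The last clause holds because the root is, uniformly in [x], close to the
    [n]-th iterate, a fixed polynomial in [x]. It makes the root almost commute
    with whatever [x] almost commutes with, and for [k = 0] it gives the exact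
    commutation. *)
Lemma sqrt_exists x : nrm x <= 1 -> exists s,
  [/\ s * s = 1 - x, nrm (1 - s) <= 1, adj x = x -> adj s = s,
      forall c, GRing.comm x c -> GRing.comm s c &
      forall n c k, nrm (commut x c) <= k ->
        nrm (commut s c) <= n%:R * k + 4 / n.+1%:R * nrm c].
Proof.
move=> x1.
have y1 n : nrm (sqrt_iter x n) <= 1.
  by apply: le_trans (nrm_sqrt_iter _ x1) _; case/andP: (sqrt_bound_ge n).
have tail m n : (n <= m)%N ->
    nrm (sqrt_iter x m - sqrt_iter x n) <= 2 / n.+1%:R.
  move=> nm; apply: le_trans (nrm_sqrt_iterB x1 nm) _.
  have /andP[_ hi] := sqrt_bound_ge m; have /andP[lo _] := sqrt_bound_ge n.
  have : 2 / n.+2%:R <= 2 / n.+1%:R :> R.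
    by rewrite ler_pM2l // lef_pV2 ?posrE ?ltr0Sn // ler_nat.
  move: lo hi; set p := 2 / n.+2%:R; set q := 2 / n.+1%:R.
  by clearbody p q; lra.
have [y yP] : exists y, forall n, nrm (sqrt_iter x n - y) <= 2 / n.+1%:R.
  have [e e0|l lP] := @nrm_complete R B (sqrt_iter x).
    have [N hN] := exists_inv_le 2 e0; exists N => m n Nm Nn.
    case: (leqP n m) => [nm|/ltnW mn]; first exact: le_trans (tail _ _ nm) (hN _ Nn).
    by rewrite nrmB; exact: le_trans (tail _ _ mn) (hN _ Nm).
  exists l => n; apply/ler_addgt0Pl => e /lP[N hN].
  have := tail _ n (leq_maxr N n); rewrite nrmB => h1.
  by have := ler_nrm_trans h1 (hN _ (leq_maxl N n)); rewrite [_ + e]addrC.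
have ylim1 : nrm y <= 1.
  apply/ler_addgt0Pl => e /(exists_inv_le 2)[n /(_ n (leqnn n)) hn].
  have h := yP n; rewrite nrmB in h.
  have := ler_nrmDD (le_trans h hn) (y1 n).
  by rewrite subrK.
have comm_quant n c k : nrm (commut x c) <= k ->
    nrm (commut (1 - y) c) <= n%:R * k + 4 / n.+1%:R * nrm c.
  move=> xc; rewrite commutD commut1 add0r commutN nrmN.
  rewrite -(subrK (sqrt_iter x n) y) commutD addrC ler_nrmDD //.
    exact: nrm_commut_sqrt_iter.
  have yn := yP n; rewrite nrmB in yn.
  apply: le_trans (nrm_commut_le yn (lexx (nrm c))) _.
  by rewrite mulrA mulrA -natrM.
exists (1 - y); split=> //.
- have yE : y = 2^-1%:C *: (x + y * y).
    apply: (@nrm_le_inv 4) => n.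
    have -> : 4 / n.+1%:R = 2 / n.+1%:R + 2 / n.+1%:R :> R.
      by rewrite -mulrDl -natrD.
    have h1 : nrm (y - sqrt_iter x n.+1) <= 2 / n.+1%:R.
      have := yP n.+1; rewrite nrmB => h; apply: le_trans h _.
      by rewrite ler_pM2l // lef_pV2 ?posrE ?ltr0Sn // ler_nat.
    have h2 : nrm (sqrt_iter x n.+1 - 2^-1%:C *: (x + y * y)) <= 2 / n.+1%:R.
      rewrite /= -scalerBr nrm_half opprD addrACA subrr add0r.
      set z := sqrt_iter x n.
      have -> : z * z - y * y = (z - y) * z + y * (z - y).
        by rewrite mulrBl mulrBr subrKA.
      have := ler_nrmDD (ler_nrmMM (yP n) (y1 n)) (ler_nrmMM ylim1 (yP n)).
      by rewrite -/z; set p := 2 / _; clearbody p; lra.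
    exact: ler_nrm_trans h1 h2.
  have : y + y = x + y * y.
    rewrite {1 2}yE -scalerDl -rmorphD /=.
    by rewrite (_ : 2^-1 + 2^-1 = 1) ?scale1r //; lra.
  move=> yy; have y2 : y * y = y + y - x by rewrite yy addrC addKr.
  rewrite mulrBl !mulrBr !mulr1 mul1r opprB addrA y2 !addrA subrK.
  by rewrite addrAC addrK.
- by rewrite opprB addrCA subrr addr0.
- move=> sa; rewrite adjB adj_one; congr (_ - _).
  apply: (@nrm_le_inv 4) => n; rewrite -(subrKA (sqrt_iter x n)).
  have := yP n; rewrite -[X in nrm X]adjK nrm_adj adjB sqrt_iter_adj // nrmB.
  move=> h; rewrite (_ : 4 / n.+1%:R = 2 / n.+1%:R + 2 / n.+1%:R).
    exact: ler_nrmDD.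
  by rewrite -mulrDl -natrD.
- move=> c xc; apply: (@nrm_le_inv (4 * nrm c)) => n.
  have := @comm_quant n c 0; rewrite {1}/commut xc subrr nrm0 lexx => /(_ isT).
  by rewrite mulr0 add0r mulrAC.
Qed.

End SquareRoot.

(** * Positive elements *)

Lemma imag_sqr (R : realType) : (0 +i* 1 : R[i]) * (0 +i* 1) = -1.
Proof.
apply/eqP; rewrite eq_complex /= !mul0r !mulr0 !mulr1.
by rewrite !addr0 !sub0r oppr0 !eqxx.
Qed.

Lemma imag_conj (R : realType) : conjc (0 +i* 1 : R[i]) = - (0 +i* 1).
Proof. by apply/eqP; rewrite eq_complex /= oppr0 !eqxx. Qed.
Section Positivity.
Variables (R : realType) (B : ucstarType R).
Implicit Types (a b c h k s : B) (t M : R).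

(** For self-adjoint [a] this says that the spectrum of [a] is nonnegative,
    without a spectrum; with this form, sums of positive elements are positive
    by the triangle inequality. *)
Definition pos a := adj a = a /\ exists2 t, 0 <= t & nrm (t%:C%:A - a) <= t.

Lemma adj_scalar t : adj (t%:C%:A : B) = t%:C%:A.
Proof. by rewrite adjZr adj_one. Qed.

(** The element [u = h + i k] satisfies [adj u * u = h * h + k * k], and [k] is
    the average of two elements of the norm of [u]. *)
Lemma nrm_circle h k M : adj h = h -> adj k = k -> GRing.comm h k ->
  nrm (h * h + k * k) <= M -> nrm k ^+ 2 <= M.
Proof.
move=> ha ka hk hM; pose i : R[i] := 0 +i* 1.
have i2 : i * i = -1 by exact: imag_sqr.
have ic : conjc i = - i by exact: imag_conj.
have iN : complex.Re `|i| = 1.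
  by rewrite normc_def /= expr0n expr1n add0r sqrtr1.
pose u := h + i *: k.
have uu : adj u * u = h * h + k * k.
  rewrite /u adjD adjZ ha ka ic mulrDl !mulrDr !scaleNr !mulNr.
  rewrite -!scalerAl -!scalerAr hk scalerA i2 scaleN1r opprK.
  by rewrite addrA addrK.
have u2 : nrm u ^+ 2 <= M by rewrite -nrm_cstar uu.
apply: le_trans u2; rewrite ler_pXn2r ?nnegrE ?nrm_ge0 //.
rewrite -[leLHS]mul1r -iN -nrmZ.
have : i *: k *+ 2 = u - adj u.
  by rewrite /u adjD adjZ ha ka ic scaleNr opprB addrC subrKA.
move=> e; have := ler_nrmB u (adj u); rewrite -e nrm_adj.
rewrite -scaler_natC nrmZr ger0_norm // -mulr2n.
by rewrite -[nrm u *+ 2]mulr_natl ler_pM2l.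
Qed.

Lemma nrm_one_sub_sqr h : adj h = h -> nrm h <= 1 -> nrm (1 - h * h) <= 1.
Proof.
move=> ha h1.
have x1 : nrm (h * h) <= 1 by rewrite -[1]mulr1 ler_nrmMM.
have [k [kk _ ka kc _]] := sqrt_exists x1.
have {}ka : adj k = k by apply: ka; rewrite adjM ha.
have hk : GRing.comm h k.
  by apply/commr_sym/kc; rewrite /GRing.comm mulrA.
rewrite -kk nrm_sqr_sa //; apply: nrm_circle ha ka hk _.
by rewrite kk addrCA subrr addr0 nrm1_le1.
Qed.

Lemma pos_sa a : pos a -> adj a = a.
Proof. by case. Qed.

Lemma posZ t a : 0 <= t -> pos a -> pos (t%:C *: a).
Proof.
move=> t0 [sa [u u0 ua]]; split; first by rewrite adjZr sa.
exists (t * u); first exact: mulr_ge0.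
rewrite rmorphM -scalerA -scalerBr nrmZr ger0_norm //.
exact: ler_wpM2l.
Qed.

Lemma nrm_shift a t t' : t <= t' ->
  nrm (t%:C%:A - a) <= t -> nrm (t'%:C%:A - a) <= t'.
Proof.
move=> tt' h; have d0 : 0 <= t' - t by rewrite subr_ge0.
have := ler_nrmDD (nrm_scalar_le B d0) h.
by rewrite addrA -scalerDl -rmorphD /= subrK.
Qed.

(** For [t > 0] with [t - a] of norm at most [t], the element [1 - a / t] lies in
    the unit ball, so that [a / t] has a square root. *)
Lemma pos_sqrt a : pos a -> exists s,
  [/\ pos s, s * s = a & forall c, GRing.comm a c -> GRing.comm s c].
Proof.
(* The witness [t] may be zero. *)
case=> sa [t t0 ta]; pose T := t + 1.
have T0 : 0 < T by rewrite ltr_wpDl.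
have Ta : nrm (T%:C%:A - a) <= T by apply: nrm_shift ta; rewrite lerDl.
pose x := 1 - T^-1%:C *: a.
have x1 : nrm x <= 1.
  have -> : x = T^-1%:C *: (T%:C%:A - a).
    by rewrite scalerBr scalerA -rmorphM /= mulVf ?gt_eqF // scale1r.
  by rewrite nrmZr ger0_norm ?invr_ge0 ?(ltW T0) // ler_pdivrMl // mulr1.
have [s [ss s1 s_sa sc _]] := sqrt_exists x1.
have xsa : adj x = x by rewrite adjB adj_one adjZr sa.
exists ((Num.sqrt T)%:C *: s); split.
- apply: posZ; first exact: sqrtr_ge0.
  by split; [exact: s_sa | exists 1; rewrite ?scale1r].
- rewrite -scalerAl -scalerAr scalerA -rmorphM /= -expr2 sqr_sqrtr ?(ltW T0) //.
  by rewrite ss opprB addrCA subrr addr0 scalerA -rmorphM /= divff ?gt_eqF //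
     scale1r.
- move=> c ac; have : GRing.comm s c.
    apply: sc; rewrite /x /GRing.comm mulrBl mulrBr mul1r mulr1.
    by rewrite -scalerAl -scalerAr ac.
  by rewrite /GRing.comm -scalerAl -scalerAr => ->.
Qed.

Lemma pos_sqr s : adj s = s -> pos (s * s).
Proof.
move=> sa; split; first by rewrite adjM sa.
pose T := nrm s ^+ 2 + 1.
have T0 : 0 < T by rewrite ltr_wpDl ?exprn_ge0 ?nrm_ge0.
exists T; first exact: ltW.
pose h := (Num.sqrt T)^-1%:C *: s.
have -> : T%:C%:A - s * s = T%:C *: (1 - h * h).
  rewrite /h -scalerAl -scalerAr scalerA -rmorphM /= -invfM -(expr2 (Num.sqrt T)).
  rewrite sqr_sqrtr ?(ltW T0) // scalerBr scalerA -rmorphM /= divff ?gt_eqF //.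
  by rewrite scale1r.
rewrite nrmZr ger0_norm ?(ltW T0) // -[leRHS]mulr1 ler_pM2l //.
apply: nrm_one_sub_sqr; first by rewrite adjZr sa.
rewrite nrmZr ger0_norm ?invr_ge0 ?sqrtr_ge0 // ler_pdivrMl ?sqrtr_gt0 //.
by rewrite mulr1 -[leLHS]ger0_norm ?nrm_ge0 // -sqrtr_sqr ler_wsqrtr // lerDl.
Qed.

Lemma posD a b : pos a -> pos b -> pos (a + b).
Proof.
move=> [sa [t t0 ta]] [sb [u u0 ub]]; split; first by rewrite adjD sa sb.
exists (t + u); first exact: addr_ge0.
by rewrite rmorphD scalerDl opprD addrACA ler_nrmDD.
Qed.

Lemma pos1 : pos (1 : B).
Proof. by rewrite -[1 : B]mulr1; apply: pos_sqr; exact: adj_one. Qed.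

Lemma pos0 : pos (0 : B).
Proof. by rewrite -(mulr0 (0 : B)); apply: pos_sqr; exact: adj0. Qed.

Lemma pos_sum I (r : seq I) (P : pred I) (F : I -> B) :
  (forall i, P i -> pos (F i)) -> pos (\sum_(i <- r | P i) F i).
Proof. by move=> h; elim/big_ind: _ => //; [exact: pos0 | exact: posD]. Qed.

Lemma pos_nrm_sub a t : adj a = a -> nrm a <= t -> pos (t%:C%:A - a).
Proof.
move=> sa at_; split; first by rewrite adjB adj_scalar sa.
exists t; first exact: le_trans (nrm_ge0 _) at_.
by rewrite opprB addrCA subrr addr0.
Qed.

Lemma pos_comm_mul a b : pos a -> pos b -> GRing.comm a b -> pos (a * b).
Proof.
move=> /pos_sqrt[s [/pos_sa sa <- sc]] /pos_sqrt[r [/pos_sa ra <- rc]] ab.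
have {}sc := sc _ ab; have sr : GRing.comm s r by apply/commr_sym/rc/commr_sym.
have -> : s * s * (r * r) = (s * r) * (s * r).
  by rewrite -!mulrA; congr (s * _); rewrite !mulrA sr.
by apply: pos_sqr; rewrite adjM sa ra.
Qed.

Lemma posX a n : pos a -> pos (a ^+ n).
Proof.
move=> pa; elim: n => [|n IH]; first exact: pos1.
by rewrite exprS; apply: pos_comm_mul => //; exact: commrX.
Qed.

(** Square roots of [a] and [t - a] commute, so [nrm_circle] applies to them. *)
Lemma pos_bound_nrm a t : 0 <= t -> pos a -> pos (t%:C%:A - a) -> nrm a <= t.
Proof.
move=> t0 /pos_sqrt[s [/pos_sa sa ss sc]] /pos_sqrt[r [/pos_sa ra rr rc]].
have rs : GRing.comm r s.
  apply: rc; rewrite -ss /GRing.comm mulrBl mulrBr -mulrA; congr (_ - _).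
  by rewrite -scalerAl -scalerAr mul1r mulr1.
rewrite -ss nrm_sqr_sa //; apply: (nrm_circle ra sa rs).
by rewrite rr ss subrK nrm_scalar_le.
Qed.

Lemma pos_le_nrm a b : pos a -> pos (b - a) -> nrm a <= nrm b.
Proof.
move=> pa pba; apply: (pos_bound_nrm (nrm_ge0 _) pa).
have sb : adj b = b.
  by have := pos_sa pba; rewrite adjB (pos_sa pa) => /addIr.
have := posD (pos_nrm_sub sb (lexx _)) pba.
by rewrite addrA subrK.
Qed.

End Positivity.

(** * Positivity of the elements [adj a * a], and the order *)

Section Order.
Variables (R : realType) (B : ucstarType R).
Implicit Types (a b c g h p s u w : B) (t M : R).

Lemma pos_nrm_compl a : pos a -> nrm ((nrm a)%:C%:A - a) <= nrm a.
Proof.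
move=> pa; apply: pos_bound_nrm (nrm_ge0 _) _ _.
  by apply: pos_nrm_sub => //; exact: pos_sa.
by rewrite opprB addrCA subrr addr0.
Qed.

Lemma adj_mulV a : adj (adj a * a) = adj a * a.
Proof. by rewrite adjM adjK. Qed.

Lemma mul_shift_sqr t p : p * (t%:C%:A + p) * (t%:C%:A + p) -
  (2 * t)%:C *: (p * p) = (t * t)%:C *: p + p ^+ 3.
Proof.
have tp : t%:C%:A * p = p * t%:C%:A.
  by rewrite -scalerAl -scalerAr mul1r mulr1.
have tE x : t%:C *: x = t%:C%:A * x by rewrite -scalerAl mul1r.
rewrite mulr_natl mulr2n rmorphD rmorphM /= scalerDl -scalerA.
rewrite [t%:C *: (p * p)]tE [t%:C *: p]tE [t%:C *: (_ * p)]tE.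
rewrite !exprS expr0; move: (t%:C%:A) tp => z zp; clear tE.
have -> : p * (z + p) * (z + p) = z * z * p + (z * p * p) *+ 2 + p * p * p.
  have -> : z * z * p = p * z * z by rewrite -mulrA zp mulrA zp.
  have -> : z * p * p = p * p * z by rewrite zp -[LHS]mulrA zp mulrA.
  have e : p * z * p = p * p * z by rewrite -[LHS]mulrA zp mulrA.
  transitivity (p * z * z + p * z * p + p * p * z + p * p * p); first ncring.
  by rewrite e; ncring.
by ncring.
Qed.

(** If [P = - (adj c * c)] is positive then so is [c * adj c], because
    [adj c * c + c * adj c] is twice the sum of the squares of the real and
    imaginary parts of [c]. Both have norm [t = nrm c ^+ 2]. The identity
    [(t - c * adj c) * c = c * (t + P)] transports the bound [t] on the norm of
    [t - c * adj c] to [P * (t + P) * (t + P)], whose norm is then at most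
    [t ^+ 3]; but it dominates [2 * t * P * P], of norm [2 * t ^+ 3]. *)
Lemma pos_opp_cstar_eq0 c : pos (- (adj c * c)) -> c = 0.
Proof.
move=> pP; set P := - (adj c * c) in pP.
have pcc : pos (c * adj c).
  pose i : R[i] := 0 +i* 1.
  have i2 : i * i = -1 by exact: imag_sqr.
  have ic : conjc i = - i by exact: imag_conj.
  pose x := c + adj c; pose y := i *: (c - adj c).
  have px : pos (x * x) by apply: pos_sqr; rewrite adjD adjK addrC.
  have py : pos (y * y).
    apply: pos_sqr; rewrite /y adjZ adjB adjK ic scaleNr -scalerN opprB.
    by [].
  have -> : c * adj c = 2^-1%:C *: (x * x + y * y + (P + P)).
    rewrite /y -scalerAl -scalerAr scalerA i2 scaleN1r /x /P.
    have -> : (c + adj c) * (c + adj c) + - ((c - adj c) * (c - adj c)) +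
        (- (adj c * c) - adj c * c) = (c * adj c) *+ 2 by ncring.
    by rewrite -scaler_natC scalerA -rmorphM /= mulVf ?pnatr_eq0 // scale1r.
  by apply: posZ; rewrite ?invr_ge0 //; do !apply: posD.
set t := nrm c ^+ 2.
have t0 : 0 <= t by rewrite exprn_ge0 ?nrm_ge0.
have nP : nrm P = t by rewrite nrmN nrm_cstar.
pose Q := t%:C%:A - c * adj c.
have nQ : nrm Q <= t by have := pos_nrm_compl pcc; rewrite nrm_cstar'.
have Qc : Q * c = c * (t%:C%:A + P).
  rewrite /Q /P mulrBl mulrBr -scalerAl -scalerAr mul1r mulr1 mulrA.
  by [].
have le3 : nrm (adj c * (Q * (Q * c))) <= nrm c * (t * (t * nrm c)).
  by rewrite !ler_nrmMM ?nrm_adj.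
have E : adj c * (Q * (Q * c)) = - (P * (t%:C%:A + P) * (t%:C%:A + P)).
  by rewrite Qc [Q * (c * _)]mulrA Qc !mulrA /P !mulNr opprK.
rewrite E nrmN in le3.
have ge3 : nrm ((2 * t)%:C *: (P * P)) <= nrm (P * (t%:C%:A + P) * (t%:C%:A + P)).
  apply: pos_le_nrm.
    apply: posZ; first by rewrite mulr_ge0.
    by apply: pos_sqr; exact: pos_sa.
  rewrite mul_shift_sqr.
  apply: posD; last exact: posX.
  by apply: posZ => //; exact: mulr_ge0.
have := le_trans ge3 le3.
rewrite nrmZr ger0_norm; last exact: mulr_ge0.
rewrite nrm_sqr_sa ?nP; last exact: pos_sa.
have -> : nrm c * (t * (t * nrm c)) = t * t ^+ 2 by rewrite /t; ring.
rewrite -subr_le0 (_ : _ - _ = t ^+ 3); last by ring.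
move=> t3; apply: nrm0_eq0; apply/eqP.
have /eqP : t ^+ 3 = 0 by apply/le_anti; rewrite t3 exprn_ge0.
by rewrite !expf_eq0 /=.
Qed.

(** With [b = adj a * a], [s = |b|] and [n = s - b] twice the negative part of
    [b], one has [adj (a * n) * (a * n) = n * b * n = - n * s * n], so that
    [a * n = 0] by [pos_opp_cstar_eq0], and then [n = 0]. *)
Lemma pos_cstar a : pos (adj a * a).
Proof.
set b := adj a * a; have bsa : adj b = b by exact: adj_mulV.
have [s [ps ss sc]] := pos_sqrt (pos_sqr bsa).
have sb : GRing.comm s b by apply: sc; rewrite /GRing.comm mulrA.
have [r [pr rr rc]] := pos_sqrt ps.
pose n := s - b; have nsa : adj n = n by rewrite adjB bsa (pos_sa ps).
have rn : GRing.comm r n by apply: rc; apply: commrB.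
have np : n * (s + b) = 0.
  have -> : n * (s + b) = s * s - b * b + (s * b - b * s) by rewrite /n; ncring.
  by rewrite ss sb !subrr addr0.
have an : a * n = 0.
  apply: pos_opp_cstar_eq0.
  have -> : - (adj (a * n) * (a * n)) = (r * n) * (r * n).
    have -> : adj (a * n) * (a * n) = n * b * n by rewrite adjM nsa !mulrA.
    have -> : r * n * (r * n) = n * s * n by rewrite {1}rn -rr !mulrA.
    have -> : n * b * n = n * (s + b) * n - n * s * n by ncring.
    by rewrite np mul0r sub0r opprK.
  by apply: pos_sqr; rewrite adjM nsa (pos_sa pr).
have bn : b * n = 0 by rewrite -mulrA an mulr0.
have n0 : n = 0.
  apply: nrm0_eq0; apply/eqP; rewrite -sqrf_eq0 -nrm_sqr_sa //.
  have -> : n * n = n * (s + b) - (n * b + n * b) by rewrite /n; ncring.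
  have -> : n * b = b * n by rewrite mulrBr mulrBl sb.
  by rewrite np bn addr0 subrr nrm0.
by have /eqP := n0; rewrite subr_eq0 => /eqP <-.
Qed.

Lemma pos_conj a c : pos a -> pos (adj c * a * c).
Proof.
move=> /pos_sqrt[s [/pos_sa sa <- _]].
have -> : adj c * (s * s) * c = adj (s * c) * (s * c) by rewrite adjM sa !mulrA.
exact: pos_cstar.
Qed.

(** The way in which the order is used: domination of [adj g * g] by [h] passes
    to norms after multiplication by [c]. *)
Lemma nrm_mul_le g h c :
  pos (h - adj g * g) -> nrm (g * c) ^+ 2 <= nrm (adj c * h * c).
Proof.
move=> gh; rewrite -nrm_cstar; apply: pos_le_nrm; first exact: pos_cstar.
have := pos_conj c gh; rewrite mulrBr mulrBl.
by rewrite adjM !mulrA.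
Qed.

Lemma pos_compl_nrm_le1 s : pos s -> pos (1 - s) -> nrm s <= 1.
Proof.
by move=> ps p1; apply: pos_bound_nrm => //; rewrite scale1r.
Qed.

Lemma comm_compl s : GRing.comm (1 - s) s.
Proof. by rewrite /GRing.comm mulrBl mulrBr mul1r mulr1. Qed.

Lemma pos_complX s n : pos s -> pos (1 - s) -> pos (1 - s ^+ n).
Proof.
move=> ps p1; elim: n => [|n IH]; first by rewrite subrr; exact: pos0.
have -> : 1 - s ^+ n.+1 = (1 - s) + s * (1 - s ^+ n).
  by rewrite mulrBr mulr1 addrA subrK -exprS.
apply: posD => //; apply: pos_comm_mul => //.
by apply: commrB; [exact: commr1 | exact: commrX].
Qed.

(** The [q + 1] elements [(1 - s) * s ^+ i], [i <= q], sum up to at most [1] and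
    the last one is the smallest. *)
Lemma nrm_compl_mulX s q : pos s -> pos (1 - s) ->
  nrm ((1 - s) * s ^+ q) <= q.+1%:R^-1.
Proof.
move=> ps p1; have cs := comm_compl s.
have pq k : pos ((1 - s) * s ^+ k).
  by apply: pos_comm_mul => //; [exact: posX | exact: commrX].
have key : pos (1 - s ^+ q.+1 - (1 - s) * s ^+ q *+ q.+1).
  elim: q => [|q IH]; first by rewrite expr1 mulr1 subrr; exact: pos0.
  have -> : 1 - s ^+ q.+2 - (1 - s) * s ^+ q.+1 *+ q.+2 =
     (1 - s ^+ q.+1 - (1 - s) * s ^+ q *+ q.+1) +
     (1 - s) * ((1 - s) * s ^+ q) *+ q.+1.
    set d := (1 - s) * s ^+ q.
    have dE : (1 - s) * s ^+ q.+1 = d - (1 - s) * d.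
      have -> : d - (1 - s) * d = s * d by ncring.
      by rewrite /d exprS !mulrA cs.
    have sE : s ^+ q.+2 = s ^+ q.+1 - (d - (1 - s) * d).
      by rewrite -dE [LHS]exprS; ncring.
    rewrite dE sE mulrSr mulrnBl.
    by move: (s ^+ _) ((1 - s) * d) ((1 - s) * d *+ _) (d *+ _) => *; ncring.
  apply: posD => //; rewrite -scaler_natC.
  apply: posZ => //; apply: pos_comm_mul => //.
  by apply: commrM; [exact: commr_refl | exact: commrX].
have q0 : 0 < q.+1%:R :> R by rewrite ltr0Sn.
have : nrm (q.+1%:R%:C *: ((1 - s) * s ^+ q)) <= 1.
  apply: pos_bound_nrm => //; first by apply: posZ => //; exact: ltW.
  have := posD key (posX q.+1 ps).
  by rewrite addrAC subrK scale1r scaler_natC.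
by rewrite nrmZr ger0_norm ?(ltW q0) // -ler_pdivlMl // mulr1.
Qed.

(** The row [(c, s)] is completed to the rotation with second row [(s, - c)],
    which preserves the sum of [adj u * u] and [adj w * w]. *)
Lemma nrm_rotation c s u w : adj c = c -> adj s = s -> GRing.comm c s ->
  c * c + s * s = 1 ->
  nrm (c * u + s * w) ^+ 2 <= nrm (adj u * u + adj w * w).
Proof.
move=> ca sa cs cs1; pose k := s * u - c * w.
rewrite -nrm_cstar; apply: pos_le_nrm; first exact: pos_cstar.
have -> : adj u * u + adj w * w - adj (c * u + s * w) * (c * u + s * w) =
          adj k * k; last exact: pos_cstar.
apply/eqP; rewrite subr_eq /k adjB adjD !adjM ca sa; apply/eqP.
transitivity (adj u * (c * c + s * s) * u + adj w * (c * c + s * s) * w +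
    (adj u * (c * s - s * c) * w + adj w * (s * c - c * s) * u)).
  by rewrite cs1 cs !subrr !mulr0 !mul0r !addr0 !mulr1.
by ncring.
Qed.

(** The compression of the diagonal matrix with entries [p'] and [p] by the unit
    row [(c, s)] does not increase the norm. *)
Lemma nrm_compression c s p p' M : adj c = c -> adj s = s -> GRing.comm c s ->
  c * c + s * s = 1 -> 0 <= M -> nrm p <= M -> nrm p' <= M ->
  nrm (c * p' * c + s * p * s) <= M.
Proof.
move=> ca sa cs cs1 M0 pM p'M; rewrite -(@ler_pXn2r _ 2) ?nnegrE ?nrm_ge0 //.
rewrite -!mulrA; apply: le_trans (nrm_rotation _ _ ca sa cs cs1) _.
have bound (q d : B) : adj d = d -> nrm q <= M ->
    pos ((M ^+ 2)%:C *: (d * d) - adj (q * d) * (q * d)).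
  move=> da qM.
  have -> : (M ^+ 2)%:C *: (d * d) - adj (q * d) * (q * d) =
     adj d * ((M ^+ 2)%:C%:A - adj q * q) * d.
    by rewrite mulrBr mulrBl -scalerAr -scalerAl mulr1 adjM da !mulrA.
  apply: pos_conj; apply: pos_nrm_sub; first exact: adj_mulV.
  by rewrite nrm_cstar ler_pXn2r ?nnegrE ?nrm_ge0.
apply: pos_bound_nrm; first exact: exprn_ge0.
  by apply: posD; exact: pos_cstar.
rewrite -cs1 scalerDr opprD addrACA.
by apply: posD; apply: bound.
Qed.

End Order.

(** * Closed ideals and quasi-central approximate units *)

Record ucideal (R : realType) (B : ucstarType R) := UCIdeal {
  uc_set :> B -> Prop;
  uc0 : uc_set 0;
  ucD : forall a b, uc_set a -> uc_set b -> uc_set (a + b);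
  ucZ : forall (z : R[i]) a, uc_set a -> uc_set (z *: a);
  ucMl : forall a b, uc_set b -> uc_set (a * b);
  ucMr : forall a b, uc_set a -> uc_set (a * b);
  uc_closed : forall a,
    (forall e, 0 < e -> exists2 b, uc_set b & nrm (a - b) <= e) -> uc_set a
}.

Lemma seq_nrm_bound (R : realType) (B : ucstarType R) (F : seq B) :
  exists2 K, 0 <= K & forall a, a \in F -> nrm a <= K.
Proof.
elim: F => [|a F [K K0 h]]; first by exists 0.
exists (nrm a + K); first by rewrite addr_ge0 ?nrm_ge0.
move=> b; rewrite inE => /orP[/eqP ->|/h bK]; first by rewrite lerDl.
by rewrite (le_trans bK) // lerDr nrm_ge0.
Qed.

Section ApproximateUnit.
Variables (R : realType) (B : ucstarType R) (I : ucideal B).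
Implicit Types (a b c g h u : B) (e M : R).

Lemma ucN a : I a -> I (- a).
Proof. by move=> h; rewrite -scaleN1r; exact: ucZ. Qed.

Lemma ucB a b : I a -> I b -> I (a - b).
Proof. by move=> ? ?; apply: ucD => //; exact: ucN. Qed.

Lemma uc_sum T (s : seq T) (P : pred T) (F : T -> B) :
  (forall i, P i -> I (F i)) -> I (\sum_(i <- s | P i) F i).
Proof. by move=> h; elim/big_ind: _ => //; [exact: uc0 | exact: ucD]. Qed.

Lemma uc_complX h n : I h -> I (1 - (1 - h) ^+ n).
Proof.
move=> Ih; elim: n => [|n IH]; first by rewrite subrr; exact: uc0.
have -> : 1 - (1 - h) ^+ n.+1 = (1 - (1 - h) ^+ n) + h * (1 - h) ^+ n.
  by rewrite exprS; ncring.
by apply: ucD => //; exact: ucMr.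
Qed.

Lemma nrm_mul_complX g h M n : 0 <= M -> pos h -> pos (1 - h) ->
  pos (M%:C *: h - adj g * g) ->
  nrm (g * (1 - h) ^+ n) ^+ 2 <= M / (n + n).+1%:R.
Proof.
move=> M0 ph p1 pg; apply: le_trans (nrm_mul_le _ pg) _.
rewrite adjX (pos_sa p1) -scalerAr -scalerAl nrmZr ger0_norm //.
rewrite ler_wpM2l //.
have -> : (1 - h) ^+ n * h * (1 - h) ^+ n =
          (1 - (1 - h)) * (1 - h) ^+ (n + n).
  rewrite subKr exprD mulrA; congr (_ * _).
  by apply/commr_sym/commrX/commr_sym/comm_compl.
by apply: nrm_compl_mulX; rewrite ?subKr.
Qed.

(** For [h] the normalized sum of the [adj g * g], the elements
    [1 - (1 - h) ^+ n] form an approximate unit: [adj g * g] is dominated by a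
    multiple of [h], and [h * (1 - h) ^+ (2 * n)] is small. Only [adj g * g] has to
    lie in [I], which is what shows that [I] is self-adjoint. *)
Lemma right_approx_unit (G : seq B) e : 0 < e ->
  (forall g, g \in G -> I (adj g * g)) ->
  exists u, [/\ I u, pos u, pos (1 - u) &
    forall g, g \in G -> nrm (g * (1 - u)) <= e].
Proof.
move=> e0 IG; pose h0 := \sum_(g <- G) adj g * g; pose M := nrm h0 + 1.
have M0 : 0 < M by rewrite ltr_wpDl ?nrm_ge0.
have ph0 : pos h0 by apply: pos_sum => g _; exact: pos_cstar.
have Ih0 : I h0.
  by rewrite /h0 big_seq; apply: uc_sum => g; exact: IG.
pose h := M^-1%:C *: h0.
have ph : pos h by apply: posZ ph0; rewrite invr_ge0 ltW.
have p1h : pos (1 - h).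
  have := pos_nrm_sub (t := 1) (pos_sa ph); rewrite scale1r; apply.
  rewrite nrmZr ger0_norm ?invr_ge0 ?(ltW M0) //.
  by rewrite ler_pdivrMl // mulr1 lerDl.
have Mh : M%:C *: h = h0.
  by rewrite scalerA -rmorphM /= divff ?gt_eqF // scale1r.
have [n hn] := exists_inv_le M (exprn_gt0 2 e0).
exists (1 - (1 - h) ^+ n); split.
- by apply: uc_complX; exact: ucZ.
- by apply: pos_complX => //; rewrite subKr.
- by rewrite subKr; exact: posX.
- move=> g gG; rewrite subKr -(@ler_pXn2r _ 2) ?nnegrE ?nrm_ge0 ?(ltW e0) //.
  apply: le_trans (hn _ (leq_addr n n)).
  apply: nrm_mul_complX => //; first exact: ltW.
  rewrite Mh /h0 (big_rem g gG) /= addrAC subrr add0r.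
  by apply: pos_sum => b _; exact: pos_cstar.
Qed.

Lemma uc_adj a : I a -> I (adj a).
Proof.
move=> Ia; apply: uc_closed => e e0.
have [|u [Iu _ _ hu]] := @right_approx_unit [:: adj a] e e0.
  by move=> g; rewrite inE => /eqP ->; rewrite adjK; exact: ucMr.
exists (adj a * u); first exact: ucMl.
have := hu (adj a); rewrite inE eqxx mulrBr mulr1; exact.
Qed.

(** The sum [u] of [N] approximate units chosen one after the other, each of them
    almost acting as a right unit on the finitely many elements of [I] built from
    the sum [E] of the previous ones. Then the new commutator is almost orthogonal to
    [commut E a], so the squares of the norms of commutators add up: the norm of
    [commut u a] only grows like the square root of [N]. *)
Lemma quasicentral_sum (G F : seq B) e N : 0 < e ->
  (forall g, g \in G -> I g) ->
  exists u, [/\ I u, pos u, pos (N%:R%:C%:A - u),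
    forall g, g \in G -> nrm (g * (N%:R%:C%:A - u)) <= N%:R * e &
    forall a, a \in F -> nrm (commut u a) ^+ 2 <= N%:R * (4 * nrm a ^+ 2 + 1)].
Proof.
move=> e0 IG; elim: N => [|N [E [IE pE p1E GE FE]]].
  exists 0; split.
  - exact: uc0.
  - exact: pos0.
  - by rewrite scale0r subrr; exact: pos0.
  - by move=> g _; rewrite scale0r subrr mulr0 nrm0 mul0r.
  - by move=> a _; rewrite /commut mul0r mulr0 subrr nrm0 expr0n mul0r.
have [K K0 KF] := seq_nrm_bound F.
pose e' := Num.min e ((2 * (1 + K) ^+ 2)^-1).
have K1 : 0 < 2 * (1 + K) ^+ 2.
  by rewrite mulr_gt0 // exprn_gt0 // ltr_wpDr.
have e'0 : 0 < e' by rewrite lt_min e0 invr_gt0.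
(* These are the elements of [I] that occur in [adj (commut E a) * commut u a]. *)
pose G' := G ++ E :: [seq E * a | a <- F] ++ [seq E * adj a | a <- F] ++
  [seq E * adj a * a | a <- F].
have IG' g : g \in G' -> I (adj g * g).
  move=> gG; apply: ucMl; move: gG; rewrite !(mem_cat, inE).
  case/or4P => [/IG //|/eqP -> //|/mapP[a _ ->]|]; first exact: ucMr.
  by case/orP => /mapP[a _ ->]; do !apply: ucMr.
have [u [Iu pu p1u Gu]] := right_approx_unit e'0 IG'.
exists (E + u).
have SE : N.+1%:R%:C%:A - (E + u) = (N%:R%:C%:A - E) + (1 - u).
  by rewrite -natr1 rmorphD /= scalerDl scale1r opprD addrACA.
rewrite SE; split.
- exact: ucD.
- exact: posD.
- exact: posD.
- move=> g gG; rewrite mulrDr -natr1 mulrDl mul1r ler_nrmDD ?GE //.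
  by rewrite (le_trans (Gu g _)) ?mem_cat ?gG // ge_min lexx.
- move=> a aF.
  set S := commut E a; set c := commut u a.
  have aK := KF a aF.
  have cross : nrm (adj S * c) <= 2^-1.
    have -> : adj S * c = adj a * (E * a * (1 - u)) -
        adj a * (E * (1 - u)) * a - (E * adj a * a * (1 - u)) +
        E * adj a * (1 - u) * a.
      by rewrite /S /c /commut adjB !adjM (pos_sa pE); ncring.
    have e1 : nrm (E * (1 - u)) <= e'.
      by apply: Gu; rewrite !(mem_cat, inE) eqxx !orbT.
    have e2 : nrm (E * a * (1 - u)) <= e'.
      by apply: Gu; rewrite !(mem_cat, inE) map_f ?orbT.
    have e3 : nrm (E * adj a * (1 - u)) <= e'.
      by apply: Gu; rewrite !(mem_cat, inE) (map_f (fun a => E * adj a)) ?orbT.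
    have e4 : nrm (E * adj a * a * (1 - u)) <= e'.
      apply: Gu; rewrite !(mem_cat, inE).
      by rewrite (map_f (fun a => E * adj a * a)) ?orbT.
    have a'K : nrm (adj a) <= K by rewrite nrm_adj.
    have := ler_nrmDD (ler_nrmBD (ler_nrmBD (ler_nrmMM a'K e2)
      (ler_nrmMM (ler_nrmMM a'K e1) aK)) e4) (ler_nrmMM e3 aK).
    move=> h; apply: (le_trans h).
    have -> : K * e' + K * e' * K + e' + e' * K = e' * (1 + K) ^+ 2 by ring.
    have : e' <= (2 * (1 + K) ^+ 2)^-1 by rewrite ge_min lexx orbT.
    rewrite invfM -ler_pdivrMr ?invr_gt0 ?exprn_gt0 ?ltr_wpDr // invrK.
    by [].
  have c2 : nrm c <= 2 * nrm a.
    have := nrm_commut_le (pos_compl_nrm_le1 pu p1u) (lexx (nrm a)).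
    by rewrite mul1r.
  rewrite commutD -/S -/c -nrm_cstar.
  have -> : adj (S + c) * (S + c) =
     adj S * S + adj S * c + adj (adj S * c) + adj c * c.
    by rewrite adjM adjK adjD; ncring.
  have h1 := ler_nrmDD (ler_nrmDD (ler_nrmDD (lexx (nrm (adj S * S))) cross)
     (lexx (nrm (adj (adj S * c))))) (lexx (nrm (adj c * c))).
  apply: le_trans h1 _; rewrite nrm_adj !nrm_cstar -[N.+1%:R]natr1 mulrDl mul1r.
  have h2 : nrm c ^+ 2 <= 4 * nrm a ^+ 2.
    have := ler_pM (nrm_ge0 _) (nrm_ge0 _) c2 c2.
    by rewrite -!expr2 exprMn -natrX.
  by have := FE a aF; rewrite -/S; lra.
Qed.

(** Quasi-central approximate units *)
(** The average of [N] approximate units as in [quasicentral_sum] has commutators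
    of order [1 / sqrt N]. *)
Lemma quasicentral_unit (G F : seq B) e : 0 < e ->
  (forall g, g \in G -> I g) ->
  exists u, [/\ I u, pos u, pos (1 - u),
    forall g, g \in G -> nrm ((1 - u) * g) <= e &
    forall a, a \in F -> nrm (commut u a) <= e].
Proof.
move=> e0 IG; have [K K0 KF] := seq_nrm_bound F.
have [n /(_ n (leqnn n)) hn] :=
  exists_inv_le (4 * K ^+ 2 + 1) (exprn_gt0 2 e0).
have IG' g : g \in map (@adj R B) G -> I g.
  by case/mapP => b /IG Ib ->; exact: uc_adj.
have [E [IE pE p1E GE FE]] := quasicentral_sum F n.+1 e0 IG'.
have n0 : 0 < n.+1%:R :> R by rewrite ltr0Sn.
have n1 : 0 <= n.+1%:R^-1 :> R by rewrite invr_ge0 ltW.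
pose u := n.+1%:R^-1%:C *: E.
have uE : 1 - u = n.+1%:R^-1%:C *: (n.+1%:R%:C%:A - E).
  by rewrite scalerBr scalerA -rmorphM /= mulVf ?gt_eqF // scale1r.
exists u; split.
- exact: ucZ.
- exact: posZ.
- by rewrite uE; exact: posZ.
- move=> g gG; rewrite -nrm_adj adjM uE adjZr (pos_sa p1E) -scalerAr nrmZr.
  rewrite ger0_norm // ler_pdivrMl //; apply: GE.
  exact: map_f.
- move=> a aF; rewrite commutZ nrmZr ger0_norm // ler_pdivrMl //.
  rewrite -(@ler_pXn2r _ 2) ?nnegrE ?nrm_ge0 ?mulr_ge0 ?(ltW e0) //.
  apply: le_trans (FE a aF) _; rewrite exprMn (expr2 n.+1%:R) -mulrA ler_pM2l //.
  move: hn; rewrite ler_pdivrMr // [_ * n.+1%:R]mulrC => hn.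
  apply: le_trans hn.
  rewrite lerD2r ler_pM2l // ler_pXn2r ?nnegrE ?nrm_ge0 //.
  exact: KF.
Qed.

End ApproximateUnit.

(** * The two corrections *)

Section NormAdjustment.
Variables (R : realType) (B : ucstarType R) (I : ucideal B).

(** The index set [T] is used both for the values of the polynomials and for the
    products that must stay small. *)
Lemma norm_adjuster (T : finType) (Q : T -> B) (C : T -> R) (F : seq B)
    (d e : R) :
  0 <= d <= 1 -> 0 < e -> (forall t, 0 <= C t) ->
  (forall t, (1 - d) * nrm (Q t) <= C t) ->
  (forall t e', 0 < e' -> exists2 i, I i & nrm (Q t - i) <= C t + e') ->
  exists v, [/\ adj v = v /\ I (1 - v), nrm v <= 1, nrm (1 - v) <= d,
    forall a, a \in F -> nrm (commut v a) <= e &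
    forall t, nrm (v * Q t) <= C t + e].
Proof.
move=> /andP[d0 d1] e0 C0 QC Qlift.
have e4 : 0 < e / 4 by rewrite divr_gt0.
have e8 : 0 < e / 8 by rewrite divr_gt0.
have /boolp.choice[i iP] t : exists z, I z /\ nrm (Q t - z) <= C t + e / 4.
  by have [z Iz hz] := Qlift t _ e4; exists z.
have Ii t : I (i t) by case: (iP t).
have iQ t : nrm (Q t - i t) <= C t + e / 4 by case: (iP t).
have [K K0 KQ] := seq_nrm_bound [seq Q t | t <- enum T].
have {}KQ t : nrm (Q t) <= K by apply: KQ; rewrite map_f ?mem_enum.
(* [n] makes the tail of the square root small; [k] is chosen small against [n]. *)
have [n /(_ n (leqnn n)) hn] := exists_inv_le (4 * K) e8.
pose k := e / (8 * n.+1%:R).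
have n1 : 1 <= n.+1%:R :> R by rewrite ler1n.
have k0 : 0 < k by rewrite divr_gt0 // mulr_gt0 // (lt_le_trans ltr01).
have nk : n.+1%:R * k = e / 8.
  have : n.+1%:R != 0 :> R by rewrite pnatr_eq0.
  by rewrite /k; move: n.+1%:R => N N0; field.
have ke : k <= e / 8 by rewrite -nk ler_peMl // ltW.
have [|u [Iu pu p1u uG uF]] := @quasicentral_unit _ _ I [seq i t | t <- enum T]
    (F ++ [seq Q t | t <- enum T]) _ k0.
  by move=> g /mapP[t _ ->].
have ui t : nrm ((1 - u) * i t) <= k by apply: uG; rewrite map_f ?mem_enum.
have uQ t : nrm (commut u (Q t)) <= k.
  by apply: uF; rewrite mem_cat map_f ?mem_enum ?orbT.
set c := 1 - u in p1u ui.
have ca : adj c = c by exact: pos_sa.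
have c1 : nrm c <= 1 by apply: pos_compl_nrm_le1; rewrite ?subKr.
have cc a : nrm (commut c a) = nrm (commut u a).
  by rewrite commutD commut1 add0r commutN nrmN.
have c2 a : nrm (commut u a) <= k -> nrm (commut (c * c) a) <= 2 * k.
  rewrite -cc => h; have := nrm_commutM c1 c1 h h.
  by rewrite mul1r mulr1 mulr_natl.
have cc1 : nrm (c * c) <= 1 by rewrite -[1]mulr1 ler_nrmMM.
have [s [ss _ sa sc scomm]] := sqrt_exists cc1.
have {}sa : adj s = s by apply: sa; rewrite adjM ca.
have cs : GRing.comm c s by apply/commr_sym/sc; rewrite /GRing.comm mulrA.
have ss1 : nrm (s * s) <= 1 by rewrite ss; exact: nrm_one_sub_sqr.
have s1 : nrm s <= 1.
  by rewrite -(@ler_pXn2r _ 2) ?nnegrE ?nrm_ge0 // -nrm_sqr_sa // expr1n.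
pose v := 1 - d%:C *: (s * s).
have vE : v = (1 - d)%:C%:A + d%:C *: (c * c).
  rewrite /v ss scalerBr rmorphB rmorph1 /= scalerBl scale1r.
  by move: (d%:C%:A) (_ *: (c * c)) => *; ncring.
have Iss : I (s * s).
  have -> : s * s = u + u - u * u by rewrite ss /c; ncring.
  by apply: ucB; [exact: ucD | exact: ucMr].
exists v; split.
- split; first by rewrite /v adjB adj_one adjZr adjM sa.
  by rewrite /v subKr; exact: ucZ.
- have d1' : 0 <= 1 - d by rewrite subr_ge0.
  have dcc : nrm (d%:C *: (c * c)) <= d.
    by rewrite nrmZr ger0_norm // -[leRHS]mulr1 ler_wpM2l.
  by have := ler_nrmDD (nrm_scalar_le B d1') dcc; rewrite -vE subrK.
- by rewrite /v subKr nrmZr ger0_norm // -[leRHS]mulr1 ler_wpM2l.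
- move=> a aF; have ak : nrm (commut u a) <= k by apply: uF; rewrite mem_cat aF.
  rewrite vE commutD !commutZ commut1 scaler0 add0r nrmZr ger0_norm //.
  apply: (@le_trans _ _ (1 * (2 * k))).
    by apply: ler_pM => //; [exact: nrm_ge0 | exact: c2].
  by rewrite mul1r; lra.
- move=> t; pose q' := Q t - i t; pose q1 := (1 - d)%:C *: Q t.
  have vT : v * Q t = (c * q' * c + s * q1 * s) +
      (c * commut c (Q t) + c * i t * c + (1 - d)%:C *: (s * commut s (Q t))).
    have -> : v = c * c + (1 - d)%:C *: (s * s).
      rewrite rmorphB rmorph1 /= scalerBl scale1r /v ss.
      by move: (_ *: (1 - c * c)) => *; ncring.
    rewrite mulrDl /q1 /q' /commut -!scalerAl -scalerAr -scalerAl.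
    have -> : s * (s * Q t - Q t * s) = s * s * Q t - s * Q t * s by ncring.
    rewrite scalerBr.
    move: (_ *: (s * s * Q t)) (_ *: (s * Q t * s)) => *.
    by ncring.
  have T1 : nrm (c * q' * c + s * q1 * s) <= C t + e / 4.
    apply: nrm_compression => //.
    + by rewrite ss addrCA subrr addr0.
    + by rewrite addr_ge0 // ltW.
    + rewrite nrmZr ger0_norm ?subr_ge0 //; apply: le_trans (QC t) _.
      by rewrite lerDl ltW.
    + exact: iQ.
  have T2 : nrm (c * commut c (Q t)) <= k.
    by rewrite -[k]mul1r ler_nrmMM // cc.
  have T3 : nrm (c * i t * c) <= k by rewrite -[k]mulr1 ler_nrmMM.
  have T4 : nrm (commut s (Q t)) <= 3 * (e / 8).
    apply: le_trans (scomm n _ _ (c2 _ (uQ t))) _.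
    have h1 : n%:R * (2 * k) <= 2 * (e / 8).
      rewrite mulrCA -nk; apply: ler_wpM2l => //.
      by apply: ler_wpM2r; [exact: ltW | rewrite ler_nat].
    have h2 : 4 / n.+1%:R * nrm (Q t) <= e / 8.
      apply: le_trans hn; rewrite mulrAC ler_wpM2r ?invr_ge0 //.
      by rewrite ler_wpM2l.
    by have := lerD h1 h2; set x := _ + _; lra.
  have T5 : nrm ((1 - d)%:C *: (s * commut s (Q t))) <= 3 * (e / 8).
    rewrite nrmZr ger0_norm ?subr_ge0 // -[leRHS]mul1r.
    apply: ler_pM => //; rewrite ?subr_ge0 ?nrm_ge0 ?gerBl //.
    by rewrite -[leRHS]mul1r ler_nrmMM.
  rewrite vT.
  have := ler_nrmDD T1 (ler_nrmDD (ler_nrmDD T2 T3) T5).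
  by lra.
Qed.

End NormAdjustment.

Section ProductStep.
Variables (R : realType) (B : ucstarType R) (I : ucideal B).

Lemma complX_mul (h x : B) n : nrm (1 - h) <= 1 ->
  nrm ((1 - (1 - h) ^+ n) * x) <= n%:R * nrm (h * x) /\
  (I (h * x) -> I ((1 - (1 - h) ^+ n) * x)).
Proof.
move=> h1; elim: n => [|n [IH1 IH2]].
  by rewrite subrr !mul0r nrm0; split=> // _; exact: uc0.
have -> : (1 - (1 - h) ^+ n.+1) * x =
    (1 - (1 - h) ^+ n) * x + (1 - h) ^+ n * (h * x).
  by rewrite exprSr; ncring.
split=> [|Ihx]; last by apply: ucD; [exact: IH2 | exact: ucMl].
rewrite -[n.+1%:R]natr1 [leRHS]mulrDl mul1r ler_nrmDD //.
by rewrite -[leRHS]mul1r ler_nrmMM // ler_nrmX.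
Qed.

Lemma complX_factor (h : B) m : pos h -> pos (1 - h) ->
  exists2 g, 1 - (1 - h) ^+ m = g * h &
    pos g /\ GRing.comm g (1 - h).
Proof.
move=> ph p1; elim: m => [|m [g gE [pg gc]]].
  exists 0; first by rewrite subrr mul0r.
  by split; [exact: pos0 | exact/commr_sym/commr0].
exists (g + (1 - h) ^+ m).
  by rewrite mulrDl -gE exprSr; ncring.
split; first by apply: posD => //; exact: posX.
by apply/commr_sym/commrD; [exact: commr_sym | exact: commrX].
Qed.

(** Cauchy-Schwarz for [a * w * adj b], with [w] split as a square. *)
Lemma sandwich_bound (a b w h : B) M N : 0 <= M -> 0 <= N ->
  pos (M%:C *: h - adj a * a) -> pos (M%:C *: h - adj b * b) ->
  pos w -> GRing.comm w h -> M * nrm (w * h) <= N ->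
  nrm (a * w * adj b) <= N.
Proof.
move=> M0 N0 pa pb pw wh whN; have [p [/pos_sa sp pp pc]] := pos_sqrt pw.
have {}pc := pc _ wh.
have key c : pos (M%:C *: h - adj c * c) -> nrm (c * p) <= Num.sqrt N.
  move=> hc0; have hc := nrm_mul_le p hc0.
  rewrite -(@ler_pXn2r _ 2) ?nnegrE ?nrm_ge0 ?sqrtr_ge0 // sqr_sqrtr //.
  apply: le_trans hc _; rewrite sp -scalerAr -scalerAl nrmZr ger0_norm //.
  by rewrite -mulrA -pc mulrA pp.
rewrite -pp (_ : a * (p * p) * adj b = (a * p) * adj (b * p)); last first.
  by rewrite adjM sp !mulrA.
rewrite -[N]sqr_sqrtr // expr2 ler_nrmMM ?nrm_adj ?key //.
Qed.

(** In the application [eta = t ^+ 3], [m] is of order [1 / t ^+ 2], and [q] is a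
    large multiple of [r]: the displacement is then [O(t)], and the products
    are divided by any prescribed constant. *)
Lemma product_step (r : nat) (X : 'I_r -> B) (K eta D e : R) (m q : nat) :
  1 <= K -> 0 <= eta -> 0 <= D -> 0 < e ->
  (forall k, nrm (X k) <= K) ->
  (forall k l, I (X k * X l)) ->
  (forall k l, nrm (X k * X l) <= eta) ->
  (r%:R * K ^+ 2 + 1) / (m + m).+1%:R <= D ^+ 2 ->
  exists X' : 'I_r -> B,
    [/\ forall k, I (X' k - X k),
        forall k, nrm (X' k - X k) <= 2 * ((m * q)%:R * eta) + D + e &
        forall k l, nrm (X' k * X' l) <= 2 * (r%:R * eta / q.+1%:R) + e].
Proof.
move=> K1 eta0 D0 e0 XK IXX XXeta MD; set M := r%:R * K ^+ 2 + 1 in MD.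
have K0 : 0 <= K by exact: le_trans ler01 K1.
have r0 : 0 <= r%:R :> R by [].
have M1 : 1 <= M by rewrite lerDr mulr_ge0 // exprn_ge0.
have M0 : 0 < M by exact: lt_le_trans ltr01 M1.
pose h0 := \sum_k adj (X k) * X k.
pose h := M^-1%:C *: h0.
have ph : pos h.
  apply: posZ; first by rewrite invr_ge0 ltW.
  by apply: pos_sum => k _; exact: pos_cstar.
have Mh : M%:C *: h = h0.
  by rewrite scalerA -rmorphM /= divff ?gt_eqF // scale1r.
have h0M : nrm h0 <= M.
  apply: le_trans (ler_nrm_sum _ _ _) _.
  apply: (@le_trans _ _ (\sum_(k < r) K ^+ 2)).
    by apply: ler_sum => k _; rewrite nrm_cstar ler_pXn2r ?nnegrE ?nrm_ge0.
  by rewrite sumr_const card_ord -mulr_natl lerDl.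
have p1h : pos (1 - h).
  have := pos_nrm_sub (t := 1) (pos_sa ph); rewrite scale1r; apply.
  by rewrite nrmZr ger0_norm ?invr_ge0 ?(ltW M0) // ler_pdivrMl // mulr1.
have pX k : pos (M%:C *: h - adj (X k) * X k).
  rewrite Mh /h0 (bigD1 k) //= addrAC subrr add0r.
  by apply: pos_sum => l _; exact: pos_cstar.
have n1h : nrm (1 - h) <= 1 by apply: pos_compl_nrm_le1; rewrite ?subKr.
pose s := (1 - h) ^+ m; pose Phi := s ^+ q.
have ps : pos s by exact: posX.
have p1s : pos (1 - s) by apply: pos_complX; rewrite ?subKr.
have ns : nrm s <= 1 by exact: pos_compl_nrm_le1.
have n1s : nrm (1 - s) <= 1 by apply: pos_compl_nrm_le1; rewrite ?subKr.
have nPhi : nrm Phi <= 1 by exact: ler_nrmX.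
have hXE k : h * X k = M^-1%:C *: \sum_l adj (X l) * (X l * X k).
  rewrite -scalerAl mulr_suml; congr (_ *: _).
  by apply: eq_bigr => l _; rewrite mulrA.
have hX k : nrm (h * X k) <= eta.
  rewrite hXE nrmZr ger0_norm ?invr_ge0 ?(ltW M0) // ler_pdivrMl //.
  apply: le_trans (ler_nrm_sum _ _ _) _.
  apply: (@le_trans _ _ (\sum_(l < r) K * eta)).
    by apply: ler_sum => l _; rewrite ler_nrmMM // nrm_adj.
  rewrite sumr_const card_ord -mulr_natl mulrA ler_wpM2r //.
  have : r%:R * K <= r%:R * K ^+ 2.
    by rewrite ler_wpM2l // expr2 ler_peMr.
  by rewrite /M; lra.
have IhX k : I (h * X k).
  by rewrite hXE; apply: ucZ; apply: uc_sum => l _; exact: ucMl.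
have PhiE : Phi = (1 - h) ^+ (m * q) by rewrite exprM.
pose f k := (1 - Phi) * X k.
have [nf If] : (forall k, nrm (f k) <= (m * q)%:R * eta) /\ forall k, I (f k).
  split=> k; have [h1 h2] := complX_mul (X k) (m * q) n1h; last first.
    by rewrite /f PhiE; exact: h2.
  by rewrite /f PhiE; apply: le_trans h1 _; rewrite ler_wpM2l.
have Xs k : nrm (X k * s) <= D.
  rewrite -(@ler_pXn2r _ 2) ?nnegrE ?nrm_ge0 //.
  by apply: le_trans MD; apply: nrm_mul_complX => //; exact: ltW.
have K4 : 0 < 8 * K by rewrite mulr_gt0 // (lt_le_trans ltr01 K1).
pose t := e / (8 * K).
have t0 : 0 < t by rewrite divr_gt0.
have tK : t * K = e / 8 by rewrite /t; field; rewrite gt_eqF // (lt_le_trans ltr01 K1).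
have te : t <= e / 8 by rewrite -tK ler_peMr // ltW.
have [|u [Iu pu p1u uG uF]] := @quasicentral_unit _ _ I
    ([seq X kl.1 * X kl.2 | kl <- enum {: 'I_r * 'I_r}] ++
     [seq f k | k <- enum 'I_r]) [seq X k | k <- enum 'I_r] _ t0.
  by move=> g; rewrite mem_cat => /orP[] /mapP[k _ ->].
have uXX k l : nrm ((1 - u) * (X k * X l)) <= t.
  apply: uG; rewrite mem_cat; apply/orP; left.
  by apply/mapP; exists (k, l); rewrite ?mem_enum.
have uf k : nrm ((1 - u) * f k) <= t.
  by apply: uG; rewrite mem_cat map_f ?mem_enum ?orbT.
have uX k : nrm (commut u (X k)) <= t by apply: uF; rewrite map_f ?mem_enum.
have nu : nrm u <= 1 by exact: pos_compl_nrm_le1.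
have n1u : nrm (1 - u) <= 1 by apply: pos_compl_nrm_le1; rewrite ?subKr.
have nus : nrm (1 - u * s) <= 2.
  by apply: ler_nrmBD; [exact: nrm1_le1 | rewrite -[1]mulr1 ler_nrmMM].
have diffE k : Phi * X k * (1 - u * s) - X k =
    - (f k * (1 - u * s)) - (u * (X k * s) - commut u (X k) * s).
  by rewrite /f /commut; ncring.
exists (fun k => Phi * X k * (1 - u * s)); split=> [k|k|k l].
- rewrite diffE /commut; apply: ucB; first by apply: ucN; exact: ucMr.
  apply: ucB; first exact: ucMr.
  by apply: ucMr; apply: ucB; [exact: ucMr | exact: ucMl].
- rewrite diffE.
  have h1 : nrm (- (f k * (1 - u * s))) <= (m * q)%:R * eta * 2.
    by rewrite nrmN ler_nrmMM.
  have h2 : nrm (u * (X k * s)) <= 1 * D by rewrite ler_nrmMM.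
  have h3 : nrm (commut u (X k) * s) <= t * 1 by rewrite ler_nrmMM.
  have := ler_nrmBD h1 (ler_nrmBD h2 h3).
  by move=> h4; apply: le_trans h4 _; lra.
- pose Z := X k * ((1 - s) * Phi) * X l.
  have nZ : nrm Z <= r%:R * eta / q.+1%:R.
    have [g gE [pg gc]] := complX_factor m ph p1h.
    have hgc : GRing.comm g h.
      rewrite -[h](subKr 1); apply: commrB => //; exact: commr1.
    have gPhi : GRing.comm g Phi by rewrite PhiE; exact: commrX.
    have hPhi : GRing.comm h Phi.
      by rewrite PhiE; apply/commrX/commr_sym/comm_compl.
    pose w := g * Phi.
    have pw : pos w by apply: pos_comm_mul => //; exact: posX.
    have wh : GRing.comm w h.
      by apply/commr_sym/commrM => //; exact: commr_sym.
    have whE : w * h = (1 - s) * Phi.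
      by rewrite /s gE /w -mulrA -hPhi mulrA.
    have nwh : M * nrm (w * h) <= M / q.+1%:R.
      by rewrite whE ler_pM2l //; exact: nrm_compl_mulX.
    have ZE : Z = M^-1%:C *: \sum_j X k * w * adj (X j) * (X j * X l).
      rewrite /Z -whE -!mulrA hXE !mulrA -!scalerAr mulr_sumr; congr (_ *: _).
      by apply: eq_bigr => j _; rewrite !mulrA.
    rewrite ZE nrmZr ger0_norm ?invr_ge0 ?(ltW M0) // ler_pdivrMl //.
    apply: le_trans (ler_nrm_sum _ _ _) _.
    apply: (@le_trans _ _ (\sum_(j < r) M / q.+1%:R * eta)).
      apply: ler_sum => j _; rewrite ler_nrmMM //.
      apply: (sandwich_bound (M := M) (h := h)) => //; first exact: ltW.
      by rewrite divr_ge0 // ltW.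
    rewrite sumr_const card_ord -[_ *+ r]mulr_natl.
    have -> : r%:R * (M / q.+1%:R * eta) = M * (r%:R * eta / q.+1%:R); last by [].
    by move: (q.+1%:R^-1) => z; ring.
  pose Y := X k * (1 - u * s) * Phi * X l.
  (* The last two terms come from [u * (1 - s)], the others from [1 - u]. *)
  have YE : Y = (1 - u) * (X k * X l) + commut u (X k) * X l -
      X k * ((1 - u) * f l) + (u * Z - commut u (X k) * ((1 - s) * Phi * X l)).
    by rewrite /Y /Z /f /commut; ncring.
  have n1 : nrm (commut u (X k) * X l) <= t * K by rewrite ler_nrmMM.
  have n2 : nrm (X k * ((1 - u) * f l)) <= K * t by rewrite ler_nrmMM.
  have n3 : nrm (u * Z) <= 1 * (r%:R * eta / q.+1%:R) by rewrite ler_nrmMM.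
  have n4 : nrm (commut u (X k) * ((1 - s) * Phi * X l)) <= t * (1 * 1 * K).
    by rewrite !ler_nrmMM.
  have nY : nrm Y <= r%:R * eta / q.+1%:R + e / 2.
    rewrite YE; have := ler_nrmDD (ler_nrmBD (ler_nrmDD (uXX k l) n1) n2)
      (ler_nrmBD n3 n4).
    by move=> h1; apply: le_trans h1 _; set z := _ / _; lra.
  have -> : Phi * X k * (1 - u * s) * (Phi * X l * (1 - u * s)) =
      Phi * Y * (1 - u * s) by rewrite /Y; ncring.
  apply: le_trans (ler_nrmMM (ler_nrmMM nPhi nY) nus) _.
  by set z := _ / _; lra.
Qed.

End ProductStep.

(** * Convergence of the corrections *)

Section Iteration.
Variables (R : realType) (B : ucstarType R) (I : ucideal B) (r : nat).
Implicit Types (X Y : 'I_r -> B) (f : ('I_r -> B) -> B).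

Definition locally_lipschitz f := forall K, 0 <= K -> exists2 L, 0 <= L &
  forall X Y t, (forall k, nrm (X k) <= K) -> (forall k, nrm (Y k) <= K) ->
    (forall k, nrm (X k - Y k) <= t) -> 0 <= t -> nrm (f X - f Y) <= L * t.

(** Homogeneity survives approximately for multipliers that almost commute with
    the finitely many elements occurring in [f X]. *)
Definition quasi_homogeneous d f := forall X, exists F : seq B,
  exists2 K, 0 <= K & forall v e, adj v = v -> nrm v <= 1 ->
    (forall a, a \in F -> nrm (commut v a) <= e) -> 0 <= e ->
    nrm (f (fun k => v * X k) - v ^+ d * f X) <= K * e.

Definition ideal_compatible f := forall X Y,
  (forall k, I (X k - Y k)) -> I (f X - f Y).

Lemma exists_half_le (e : R) : 0 < e -> exists n, 2^-1 ^+ n <= e.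
Proof.
move=> e0; have [n hn] := exists_inv_le 1 e0; exists n.
apply: le_trans (hn n (leqnn n)); rewrite mul1r exprVn.
by rewrite lef_pV2 ?posrE ?exprn_gt0 ?ltr0Sn // -natrX ler_nat ltn_expl.
Qed.

Lemma half_le1 n : 2^-1 ^+ n <= 1 :> R.
Proof. by rewrite exprn_ile1 ?invr_ge0 // invf_le1 ?ler1n. Qed.

Lemma geometric_limit (u : nat -> B) :
  (forall n, nrm (u n.+1 - u n) <= 2^-1 ^+ n.+1) ->
  exists l, forall n, nrm (u n - l) <= 2^-1 ^+ n.
Proof.
move=> hu.
have tail n p : nrm (u (n + p)%N - u n) <= 2^-1 ^+ n - 2^-1 ^+ (n + p).
  elim: p => [|p IH]; first by rewrite addn0 !subrr nrm0.
  have := ler_nrm_trans (hu (n + p)%N) IH; rewrite addnS.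
  by move=> h; apply: le_trans h _; rewrite exprS; lra.
have tail' n m : (n <= m)%N -> nrm (u m - u n) <= 2^-1 ^+ n.
  move=> /subnKC <-; apply: le_trans (tail _ _) _.
  by rewrite gerBl exprn_ge0 // invr_ge0.
have [e e0|l lP] := @nrm_complete R B u.
  have [N hN] := exists_half_le e0; exists N => m n Nm Nn.
  have mono p : (N <= p)%N -> 2^-1 ^+ p <= e.
    move=> Np; apply: le_trans hN.
    by rewrite ler_wiXn2l ?invr_ge0 // invf_le1 ?ler1n.
  case: (leqP n m) => [/tail' h|/ltnW/tail' h]; first exact: le_trans h (mono _ Nn).
  by rewrite nrmB; exact: le_trans h (mono _ Nm).
exists l => n; apply/ler_addgt0Pl => e /lP[N hN].
have h1 := tail' n _ (leq_maxr N n); rewrite nrmB in h1.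
by have := ler_nrm_trans h1 (hN _ (leq_maxl N n)); rewrite [_ + e]addrC.
Qed.

Variables (J : nat) (P : 'I_J -> ('I_r -> B) -> B) (d : 'I_J -> nat).
Variables (C : 'I_J -> R) (x : 'I_r -> B).
Hypothesis d1 : forall j, (1 <= d j)%N.
Hypothesis C0 : forall j, 0 < C j.
Hypothesis Plip : forall j, locally_lipschitz (P j).
Hypothesis Phom : forall j, quasi_homogeneous (d j) (P j).
Hypothesis Pmod : forall j, ideal_compatible (P j).
Hypothesis xx : forall k l, I (x k * x l).
Hypothesis Px : forall j e, 0 < e ->
  exists2 z, I z & nrm (P j x - z) <= C j + e.

Lemma ideal_mul_congr (a a' b b' : B) :
  I (a - a') -> I (b - b') -> I (a' * b') -> I (a * b).
Proof.
move=> ha hb hab.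
have -> : a * b = (a - a') * b + a' * (b - b') + a' * b' by ncring.
by do !apply: ucD; rewrite //; [exact: ucMr | exact: ucMl].
Qed.

(** Choosing [delta = 1] also starts the iteration: nothing is then assumed of the
    norms of the products and of the [P j X]. *)
Lemma adjust_step X (K delta eta e : R) : 0 <= K -> 0 <= eta -> 0 < e ->
  0 <= delta <= 1 ->
  (forall k, I (X k - x k)) -> (forall k, nrm (X k) <= K) ->
  (forall k l, (1 - delta) * nrm (X k * X l) <= eta) ->
  (forall j, (1 - delta) * nrm (P j X) <= C j) ->
  exists X', [/\ forall k, I (X' k - x k),
    forall k, nrm (X' k) <= nrm (X k),
    forall k, nrm (X' k - X k) <= delta * K,
    forall k l, nrm (X' k * X' l) <= eta + e &
    forall j, nrm (P j X') <= C j + e].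
Proof.
move=> K0 eta0 e0 delta01 IX XK XX PX.
have /boolp.choice[F /boolp.choice[KF hF]] : forall j, exists F : seq B, exists KF : R,
    0 <= KF /\ forall v e, adj v = v -> nrm v <= 1 ->
    (forall a, a \in F -> nrm (commut v a) <= e) -> 0 <= e ->
    nrm (P j (fun k => v * X k) - v ^+ d j * P j X) <= KF * e.
  by move=> j; have [F [KF ? ?]] := Phom j X; exists F, KF.
pose S := 1 + K + \sum_j KF j.
have KF0 j : 0 <= KF j by case: (hF j).
have sum0 : 0 <= \sum_j KF j by apply: sumr_ge0.
have KFS j : 1 + KF j <= S.
  rewrite /S (bigD1 j) //=.
  have : 0 <= \sum_(i < J | i != j) KF i by apply: sumr_ge0.
  by lra.
have S0 : 0 < S by rewrite /S; lra.
pose e' := e / S.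
have e'0 : 0 < e' by rewrite divr_gt0.
have e'S : S * e' = e by rewrite /e' mulrC divfK // gt_eqF.
pose Q (t : 'I_J + 'I_r * 'I_r) :=
  match t with inl j => P j X | inr kl => X kl.1 * X kl.2 end.
pose CQ (t : 'I_J + 'I_r * 'I_r) := match t with inl j => C j | inr _ => eta end.
have IXX k l : I (X k * X l) by exact: ideal_mul_congr (IX k) (IX l) (xx k l).
have [|||v [[va Iv] v1 vd vF vQ]] := @norm_adjuster R B I _ Q CQ
  (flatten [seq F j | j <- enum 'I_J] ++ [seq X k | k <- enum 'I_r])
  delta e' delta01 e'0.
- by case=> [j|_] //=; exact: ltW.
- by case=> [j|[k l]] /=; [exact: PX | exact: XX].
- case=> [j|[k l]] e1 e10 /=; last first.
    by exists (X k * X l) => //; rewrite subrr nrm0 addr_ge0 // ltW.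
  have [z Iz hz] := Px j e10.
  exists (P j X - P j x + z); first by apply: ucD => //; exact: Pmod.
  by rewrite opprD opprB addrA [P j X + _]addrC subrK.
have vX k : nrm (commut v (X k)) <= e'.
  by apply: vF; rewrite mem_cat map_f ?mem_enum ?orbT.
have dE k : v * X k - X k = - ((1 - v) * X k) by ncring.
exists (fun k => v * X k); split=> [k|k|k|k l|j].
- have -> : v * X k - x k = - ((1 - v) * X k) + (X k - x k) by ncring.
  by apply: ucD => //; apply: ucN; exact: ucMr.
- by rewrite -[leRHS]mul1r ler_nrmMM.
- by rewrite dE nrmN ler_nrmMM.
- have -> : v * X k * (v * X l) =
      v * (v * (X k * X l)) - v * (commut v (X k)) * X l.
    by rewrite /commut; ncring.
  have h1 : nrm (v * (v * (X k * X l))) <= 1 * (eta + e').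
    by apply: ler_nrmMM => //; exact: (vQ (inr (k, l))).
  have h2 : nrm (v * (commut v (X k)) * X l) <= 1 * e' * K.
    by rewrite !ler_nrmMM.
  apply: le_trans (ler_nrmBD h1 h2) _; rewrite !mul1r -addrA lerD2l.
  rewrite -e'S -[X in X + _]mul1r [e' * K]mulrC -mulrDl ler_pM2r //.
  by rewrite lerDl.
- have [_ hj] := hF j.
  have h1 : nrm (P j (fun k => v * X k) - v ^+ d j * P j X) <= KF j * e'.
    apply: hj => //; last exact: ltW.
    move=> a aF; apply: vF; rewrite mem_cat; apply/orP; left.
    by apply/flatten_mapP; exists j; rewrite ?mem_enum.
  have h2 : nrm (v ^+ d j * P j X) <= 1 * (C j + e').
    case: (d j) (d1 j) => // n _; rewrite exprSr -mulrA.
    by apply: ler_nrmMM; [exact: ler_nrmX | exact: (vQ (inl j))].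
  have := ler_nrmDD h1 h2; rewrite subrK mul1r => h; apply: le_trans h _.
  rewrite addrCA lerD2l -e'S -[X in _ + X]mul1r -mulrDl ler_pM2r //.
  by rewrite addrC.
Qed.

(** The second half is applied with [delta = E t / (c + E t)], where [c] is a lower
    bound of the [C j] and [E t] bounds the excess after the first half. *)
Lemma combined_step (K : R) : 1 <= K -> exists2 D, 0 <= D & forall n X,
  let t := 2^-1 ^+ n in
  (forall k, I (X k - x k)) -> (forall k, nrm (X k) <= K) ->
  (forall k l, nrm (X k * X l) <= t ^+ 3) ->
  (forall j, nrm (P j X) <= C j + t) ->
  exists X', [/\ forall k, I (X' k - x k),
    forall k, nrm (X' k - X k) <= D * t,
    forall k l, nrm (X' k * X' l) <= (t / 2) ^+ 3 &
    forall j, nrm (P j X') <= C j + t / 2].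
Proof.
move=> K1; have K0 : 0 <= K by exact: le_trans ler01 K1.
pose M := r%:R * K ^+ 2 + 1.
have M1 : 1 <= M by rewrite lerDr mulr_ge0 // exprn_ge0.
pose DA := 64 * r%:R + M + 1.
have DA0 : 0 <= DA by rewrite /DA; have : 0 <= r%:R :> R by []; lra.
pose K' := K + DA.
have K'0 : 0 <= K' by rewrite addr_ge0.
have /boolp.choice[L hL] : forall j, exists L : R, 0 <= L /\
    forall X Y t, (forall k, nrm (X k) <= K') -> (forall k, nrm (Y k) <= K') ->
    (forall k, nrm (X k - Y k) <= t) -> 0 <= t -> nrm (P j X - P j Y) <= L * t.
  by move=> j; have [L ? ?] := Plip j K'0; exists L.
have L0 j : 0 <= L j by case: (hL j).
pose SL := \sum_j L j.
have SL0 : 0 <= SL by apply: sumr_ge0.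
have LS j : L j <= SL.
  by rewrite /SL (bigD1 j) //= lerDl; apply: sumr_ge0.
pose E := 1 + SL * DA.
have E1 : 1 <= E by rewrite lerDl mulr_ge0.
have E0 : 0 < E by exact: lt_le_trans ltr01 E1.
(* The inverse of [S] is a positive lower bound of all the [C j]. *)
pose S := 1 + \sum_j (C j)^-1.
have S0 : 0 < S.
  by rewrite ltr_wpDr // sumr_ge0 // => j _; rewrite invr_ge0 ltW.
pose c := S^-1.
have c0 : 0 < c by rewrite invr_gt0.
have cC j : c <= C j.
  rewrite -[C j]invrK lef_pV2 ?posrE ?invr_gt0 // /S (bigD1 j) //=.
  have : 0 <= \sum_(i < J | i != j) (C i)^-1.
    by apply: sumr_ge0 => i _; rewrite invr_ge0 ltW.
  by lra.
exists (DA + E / c * K').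
  by rewrite addr_ge0 // mulr_ge0 // divr_ge0 // ltW.
move=> n X t IX XK XX PX.
have t0 : 0 < t by rewrite exprn_gt0 ?invr_gt0.
have t1 : t <= 1 by exact: half_le1.
have t30 : 0 < t ^+ 3 by rewrite exprn_gt0.
have t3 : t ^+ 3 <= t.
  by rewrite exprS ger_pMr // exprn_ile1 // ltW.
have IXX k l : I (X k * X l) by exact: ideal_mul_congr (IX k) (IX l) (xx k l).
have four : (4 ^ n)%:R * t ^+ 2 = 1.
  rewrite natrX /t -exprM mulnC exprM -exprMn expr2 -invfM -natrM divff.
    by rewrite expr1n.
  by rewrite pnatr_eq0.
have fourt : (4 ^ n)%:R * t ^+ 3 = t.
  by rewrite exprSr mulrA four mul1r.
have MD : M / (4 ^ n + 4 ^ n).+1%:R <= (M * t) ^+ 2.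
  have N0 : 0 < (4 ^ n)%:R :> R by rewrite ltr0n expn_gt0.
  rewrite ler_pdivrMr ?ltr0Sn // -[(_ + _).+1%:R]natr1 natrD.
  have M2 : M <= M ^+ 2 by rewrite expr2 ler_peMr // (le_trans ler01).
  have -> : (M * t) ^+ 2 * ((4 ^ n)%:R + (4 ^ n)%:R + 1) =
      M ^+ 2 * (((4 ^ n)%:R * t ^+ 2) *+ 2 + t ^+ 2).
    by rewrite exprMn; ring.
  rewrite four; apply: le_trans M2 _; rewrite ler_peMr ?exprn_ge0 //.
    by rewrite (le_trans ler01).
  by have := exprn_ge0 2 (ltW t0); lra.
have e0 : 0 < t ^+ 3 / 32 by rewrite divr_gt0.
have Mt0 : 0 <= M * t by rewrite mulr_ge0 ?(ltW t0) // (le_trans ler01).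
have [Y [IY YX YY]] := @product_step R B I r X K (t ^+ 3) (M * t)
  (t ^+ 3 / 32) (4 ^ n) (32 * r) K1 (ltW t30) Mt0 e0 XK IXX XX MD.
have {}YX k : nrm (Y k - X k) <= DA * t.
  apply: le_trans (YX k) _.
  have -> : (4 ^ n * (32 * r))%:R * t ^+ 3 = 32 * r%:R * t.
    by rewrite !natrM -{2}fourt; ring.
  by rewrite /DA; lra.
have {}YY k l : nrm (Y k * Y l) <= 3 / 32 * t ^+ 3.
  apply: le_trans (YY k l) _.
  have : r%:R * t ^+ 3 / (32 * r).+1%:R <= t ^+ 3 / 32.
    rewrite ler_pdivrMr ?ltr0Sn // -[(_ * _).+1%:R]natr1 natrM.
    by rewrite mulrDr mulr1; lra.
  by set z := _ / _.+1%:R; lra.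
have {}IY k : I (Y k - x k).
  have -> : Y k - x k = (Y k - X k) + (X k - x k) by ncring.
  exact: ucD.
have DAt : DA * t <= DA by rewrite ler_piMr.
have YK k : nrm (Y k) <= K'.
  have := ler_nrmDD (YX k) (XK k); rewrite subrK => h; apply: le_trans h _.
  by rewrite addrC lerD2l.
have XK' k : nrm (X k) <= K' by apply: le_trans (XK k) _; rewrite lerDl.
have DAt0 : 0 <= DA * t by rewrite mulr_ge0 // ltW.
have PY j : nrm (P j Y) <= C j + E * t.
  have [_ /(_ Y X _ YK XK' YX DAt0) h] := hL j.
  have := ler_nrmDD h (PX j); rewrite subrK => h1; apply: le_trans h1 _.
  have -> : E * t = SL * (DA * t) + t by rewrite /E; ring.
  by rewrite addrCA lerD2l lerD2r ler_wpM2r.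
have cEt : 0 < c + E * t by rewrite addr_gt0 // mulr_gt0.
pose delta := E * t / (c + E * t).
have delta1 : 1 - delta = c / (c + E * t).
  by rewrite /delta; field; rewrite gt_eqF.
have delta01 : 0 <= delta <= 1.
  apply/andP; split; first by rewrite divr_ge0 ?(ltW cEt) // ltW // mulr_gt0.
  by rewrite -subr_ge0 delta1 divr_ge0 // ltW.
have delta_le : delta <= E / c * t.
  rewrite /delta [leRHS]mulrAC ler_pM2l ?mulr_gt0 // lef_pV2 ?posrE //.
  by rewrite lerDl ltW // mulr_gt0.
have eta0 : 0 <= 3 / 32 * t ^+ 3 by rewrite mulr_ge0 ?(ltW t30) // divr_ge0.
have [||X' [IX' _ X'Y X'X' PX']] := @adjust_step Y K' delta _ _ K'0 eta0 e0 delta01 IY YK.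
- move=> k l; apply: le_trans (YY k l); rewrite ler_piMl ?nrm_ge0 //.
  by rewrite gerBl; case/andP: delta01.
- move=> j; rewrite delta1 mulrAC ler_pdivrMr //.
  apply: le_trans (ler_wpM2l (ltW c0) (PY j)) _.
  by rewrite !mulrDr [c * C j]mulrC lerD2l ler_pM2r ?cC // mulr_gt0.
exists X'; split=> // [k|k l|j].
- rewrite mulrDl; have := ler_nrm_trans (X'Y k) (YX k) => h; apply: le_trans h _.
  by rewrite addrC lerD2l [leRHS]mulrAC ler_wpM2r.
- apply: le_trans (X'X' k l) _; rewrite expr_div_n.
  by rewrite (_ : 2 ^+ 3 = 8) -?natrX //; lra.
- apply: le_trans (PX' j) _; rewrite lerD2l.
  by lra.
Qed.

Theorem nilpotent_lifting : exists X : 'I_r -> B,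
  [/\ forall k, I (X k - x k), forall k l, X k * X l = 0 &
      forall j, nrm (P j X) <= C j].
Proof.
have [K0 K00 hK0] := seq_nrm_bound [seq x k | k <- enum 'I_r].
have {}hK0 k : nrm (x k) <= K0 by apply: hK0; rewrite map_f ?mem_enum.
pose K := K0 + 1.
have K1 : 1 <= K by rewrite lerDr.
have K_0 : 0 <= K by exact: le_trans ler01 K1.
have [D D0 step] := combined_step K1.
have [i0 hi0] : exists i, D * 2^-1 ^+ i <= 2^-1.
  have h : 0 < (2 * (D + 1))^-1 :> R by rewrite invr_gt0 mulr_gt0 // ltr_wpDl.
  have [i hi] := exists_half_le h; exists i.
  have D1 : 0 < D + 1 by rewrite ltr_wpDl.
  apply: le_trans (ler_wpM2l D0 hi) _.
  rewrite invfM mulrCA ler_piMr ?invr_ge0 // ler_pdivrMr // mul1r.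
  by rewrite lerDl.
pose t n : R := 2^-1 ^+ n.
have t0 n : 0 < t n by rewrite exprn_gt0 ?invr_gt0.
have tS n : t n.+1 = t n / 2 by rewrite /t exprSr.
(* The margin [t n] below [K] is what the displacements after stage [n] add up to. *)
pose stage n (X : 'I_r -> B) := [/\ forall k, I (X k - x k),
  forall k, nrm (X k) <= K - t n,
  forall k l, nrm (X k * X l) <= t (i0 + n)%N ^+ 3 &
  forall j, nrm (P j X) <= C j + t (i0 + n)%N].
have [X0 sX0] : exists X0, stage 0 X0.
  have e0 : 0 < t i0 ^+ 3 by rewrite exprn_gt0.
  have d01 : 0 <= (1 : R) <= 1 by rewrite ler01 lexx.
  have Ix k : I (x k - x k) by rewrite subrr; exact: uc0.
  have [||X0 [h1 h2 _ h3 h4]] := @adjust_step x K0 1 0 _ K00 (lexx 0) e0 d01 Ix hK0.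
  - by move=> k l; rewrite subrr mul0r.
  - by move=> j; rewrite subrr mul0r ltW.
  exists X0; rewrite /stage addn0; split=> // [k|k l|j].
  - by rewrite /t expr0 addrK; apply: le_trans (h2 k) (hK0 k).
  - by have := h3 k l; rewrite add0r.
  - apply: le_trans (h4 j) _; rewrite lerD2l exprS ger_pMr //.
    by rewrite exprn_ile1 ?half_le1 // ltW.
have next n X : stage n X -> exists X',
    stage n.+1 X' /\ forall k, nrm (X' k - X k) <= t n.+1.
  move=> [IX XK XX PX].
  have [|X' [IX' X'X XX' PX']] := step (i0 + n)%N X IX _ XX PX.
    by move=> k; apply: le_trans (XK k) _; rewrite gerBl ltW.
  have small k : nrm (X' k - X k) <= t n.+1.
    apply: le_trans (X'X k) _; rewrite /t exprD mulrA exprS.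
    by rewrite ler_wpM2r // ltW // t0.
  exists X'; split=> //; split=> //.
  - move=> k; have := ler_nrmDD (small k) (XK k); rewrite subrK => h.
    by apply: le_trans h _; rewrite tS; lra.
  - by move=> k l; rewrite addnS tS.
  - by move=> j; rewrite addnS tS.
have /boolp.choice[g hg] : forall p : nat * ('I_r -> B), exists X',
    stage p.1 p.2 -> stage p.1.+1 X' /\ forall k, nrm (X' k - p.2 k) <= t p.1.+1.
  move=> [n X]; have [s|ns] := boolp.pselect (stage n X).
    by have [X' h] := next n X s; exists X'.
  by exists X.
pose Y := fix Y n := if n is n'.+1 then g (n', Y n') else X0.
have sY n : stage n (Y n).
  by elim: n => [|n IH] //=; case: (hg (n, Y n) IH).
have YS n k : nrm (Y n.+1 k - Y n k) <= t n.+1.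
  by have [_ h] := hg (n, Y n) (sY n); exact: h.
have /boolp.choice[X hX] : forall k, exists l, forall n, nrm (Y n k - l) <= t n.
  by move=> k; apply: geometric_limit => n; exact: YS.
have tmono n : t (i0 + n)%N <= t n.
  by rewrite /t exprD ler_piMl ?half_le1 // ltW // t0.
have YK n k : nrm (Y n k) <= K.
  by case: (sY n) => _ h _ _; apply: le_trans (h k) _; rewrite gerBl ltW.
have XK k : nrm (X k) <= K.
  have h := hX k 0; case: (sY 0) => _ /(_ k) h0 _ _.
  rewrite nrmB in h; have := ler_nrmDD h h0.
  by rewrite subrK addrCA subrr addr0.
have lim0 (a b c : R) : 0 <= c -> (forall n, a <= b + c * t n) -> a <= b.
  move=> c0 h; apply/ler_addgt0Pl => e e0.
  have ec : 0 < e / (c + 1) by rewrite divr_gt0 // ltr_wpDl.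
  have [n hn] := exists_half_le ec.
  apply: le_trans (h n) _; rewrite addrC lerD2r.
  apply: le_trans (ler_wpM2l c0 hn) _.
  rewrite mulrA ler_pdivrMr ?ltr_wpDl // mulrC ler_pM2l // lerDl //.
exists X; split=> [k|k l|j].
- apply: uc_closed => e e0; have [n hn] := exists_half_le e0.
  case: (sY n) => IY _ _ _; exists (Y n k - x k); first exact: IY.
  rewrite (_ : _ - _ = X k - Y n k); last by ncring.
  by rewrite nrmB; apply: le_trans hn.
- apply: nrm0_eq0; apply/le_anti; rewrite nrm_ge0 andbT.
  apply: (lim0 _ _ (1 + 2 * K)) => [|n]; first by rewrite addr_ge0 // mulr_ge0.
  case: (sY n) => _ _ h _.
  have -> : X k * X l = Y n k * Y n l - ((Y n k - X k) * Y n l +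
     X k * (Y n l - X l)) by ncring.
  have := ler_nrmBD (h k l) (ler_nrmDD (ler_nrmMM (hX k n) (YK n l))
    (ler_nrmMM (XK k) (hX l n))).
  move=> h1; apply: le_trans h1 _.
  have h3 : t (i0 + n)%N ^+ 3 <= t n.
    apply: le_trans (tmono n); rewrite exprS ger_pMr ?t0 //.
    by rewrite exprn_ile1 ?half_le1 // ltW // t0.
  by lra.
- have [L L0 hL] := Plip j K_0.
  apply: (lim0 _ _ (1 + L)) => [|n]; first exact: addr_ge0.
  case: (sY n) => _ _ _ h.
  have XY k : nrm (X k - Y n k) <= t n by rewrite nrmB.
  have h1 := hL X (Y n) _ XK (YK n) XY (ltW (t0 n)).
  have := ler_nrmDD h1 (h j); rewrite subrK => h2; apply: le_trans h2 _.
  by have := tmono n; lra.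
Qed.

End Iteration.

(** * Noncommutative polynomials as functions *)

Section PolynomialFunctions.
Variables (R : realType) (B : ucstarType R) (I : ucideal B) (r : nat).
Variable y : nat -> B.
Implicit Types (X Y : 'I_r -> B) (f g : ('I_r -> B) -> B) (w : seq ncLetter).

Definition uletter (v : nat -> B) (l : ncLetter) : B :=
  if l.2 then adj (v l.1) else v l.1.

Definition uword v w : B := \prod_(l <- w) uletter v l.

Definition ueval v (p : ncPoly R) : B :=
  \sum_(m <- monalg.msupp p)
    monalg.mcoeff m p *: uword v (monalg.fmonom_val m).

Lemma nrm_uletter X (K : R) l : (forall k, nrm (X k) <= K) -> 0 <= K ->
  nrm (uletter (join_vars X y) l) <= K + nrm (y (l.1 - r)%N).
Proof.
move=> XK K0; rewrite /uletter; set z := join_vars _ _ _.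
suff hz : nrm z <= K + nrm (y (l.1 - r)%N) by case: l.2; rewrite ?nrm_adj.
rewrite /z /join_vars; case: insubP => [k _ _|_]; last by rewrite lerDr.
by apply: le_trans (XK k) _; rewrite lerDl nrm_ge0.
Qed.

Lemma nrm_uletterB X Y (t : R) l : (forall k, nrm (X k - Y k) <= t) -> 0 <= t ->
  nrm (uletter (join_vars X y) l - uletter (join_vars Y y) l) <= t.
Proof.
move=> XY t0; rewrite /uletter /join_vars.
case: insubP => [k _ _|_]; last by rewrite subrr nrm0.
by case: l.2; rewrite // -adjB nrm_adj.
Qed.

Lemma uword_lipschitz w (K : R) : 0 <= K -> exists L N : R, [/\ 0 <= L, 0 <= N &
  forall X Y t, (forall k, nrm (X k) <= K) -> (forall k, nrm (Y k) <= K) ->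
    (forall k, nrm (X k - Y k) <= t) -> 0 <= t ->
    nrm (uword (join_vars X y) w) <= N /\
    nrm (uword (join_vars X y) w - uword (join_vars Y y) w) <= L * t].
Proof.
move=> K0; elim: w => [|l w [L [N [L0 N0 IH]]]].
  exists 0, 1; split=> // X Y t _ _ _ _; rewrite /uword !big_nil subrr nrm0.
  by rewrite mul0r; split=> //; exact: nrm1_le1.
pose Nl := K + nrm (y (l.1 - r)%N).
have Nl0 : 0 <= Nl by rewrite addr_ge0 ?nrm_ge0.
exists (N + Nl * L), (Nl * N); split; rewrite ?addr_ge0 ?mulr_ge0 //.
move=> X Y t XK YK XY t0; rewrite /uword !big_cons -!/(uword _ _).
have [h1 h2] := IH X Y t XK YK XY t0.
have lX := nrm_uletter l XK K0; have lY := nrm_uletter l YK K0.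
have lXY := nrm_uletterB l XY t0.
split; first exact: ler_nrmMM.
have -> : forall a a' b b' : B, a * b - a' * b' = (a - a') * b + a' * (b - b').
  by move=> *; ncring.
apply: le_trans (ler_nrmDD (ler_nrmMM lXY h1) (ler_nrmMM lY h2)) _.
by rewrite (_ : (N + Nl * L) * t = t * N + Nl * (L * t)) //; ring.
Qed.

Lemma lipschitz_sum T (s : seq T) (c : T -> R[i]) (f : T -> ('I_r -> B) -> B) :
  (forall m, locally_lipschitz (f m)) ->
  locally_lipschitz (fun X => \sum_(m <- s) c m *: f m X).
Proof.
move=> hf K K0; elim: s => [|m s [L L0 IH]].
  by exists 0 => // X Y t _ _ _ t0; rewrite !big_nil subrr nrm0 mul0r.
have [L' L'0 hL'] := hf m K K0.
have c0 : 0 <= complex.Re `|c m|.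
  by rewrite normc_def /= sqrtr_ge0.
exists (complex.Re `|c m| * L' + L); first by rewrite addr_ge0 ?mulr_ge0.
move=> X Y t XK YK XY t0; rewrite !big_cons opprD addrACA -scalerBr mulrDl.
apply: ler_nrmDD; last exact: IH.
by rewrite nrmZ -mulrA ler_wpM2l // hL'.
Qed.

Lemma ueval_lipschitz p : locally_lipschitz (fun X => ueval (join_vars X y) p).
Proof.
apply: lipschitz_sum => m K K0.
have [L [N [L0 _ h]]] := uword_lipschitz (monalg.fmonom_val m) K0.
by exists L => // X Y t XK YK XY t0; case: (h X Y t).
Qed.

Lemma nrm_commutX (v a : B) (e : R) n : nrm v <= 1 -> nrm (commut v a) <= e ->
  nrm (commut (v ^+ n) a) <= n%:R * e.
Proof.
move=> v1 va; elim: n => [|n IH].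
  by rewrite expr0 commut1 nrm0 mul0r.
rewrite exprSr; have := nrm_commutM (ler_nrmX n v1) v1 IH va.
by rewrite mul1r mulr1 -[n.+1%:R]natr1 mulrDl mul1r addrC.
Qed.

(** Each letter [X k] contributes a factor [v] on its left and each adjoint letter
    a factor [v] on its right; they are moved to the front one by one. *)
Lemma uword_homogeneous w :
  quasi_homogeneous (count (fun l : ncLetter => (l.1 < r)%N) w)
    (fun X => uword (join_vars X y) w).
Proof.
move=> X; set S := fun l : ncLetter => (l.1 < r)%N.
exists [seq uletter (join_vars X y) l | l <- w].
elim: w => [|l w [K K0 IH]].
  exists 0 => // v e _ _ _ _.
  by rewrite /uword !big_nil expr0 mulr1 subrr nrm0 mul0r.
set a := uletter (join_vars X y) l; set W := uword (join_vars X y) w in IH *.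
set n := count S w in IH *.
exists (nrm a * K + n.+1%:R * nrm W).
  by rewrite addr_ge0 // mulr_ge0 ?nrm_ge0.
move=> v e va v1 hF e0.
have {}IH : nrm (uword (join_vars (fun k => v * X k) y) w - v ^+ n * W) <= K * e.
  by apply: IH => // b bF; apply: hF; rewrite /= inE bF orbT.
have ca : nrm (commut v a) <= e by apply: hF; rewrite /= inE eqxx.
rewrite /uword !big_cons -!/(uword _ _) -/W -/a /= -/n.
move: IH; set W' := uword _ w => IH; set a' := uletter _ l.
have ca' k : (k <= n.+1)%N -> nrm (commut (v ^+ k) a * W) <= n.+1%:R * nrm W * e.
  move=> kn; rewrite mulrAC; apply: ler_nrmMM => //.
  apply: le_trans (nrm_commutX k v1 ca) _.
  by rewrite ler_wpM2r // ler_nat.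
have aK : nrm (a * (W' - v ^+ n * W)) <= nrm a * K * e.
  by rewrite -mulrA ler_nrmMM.
rewrite mulrDl.
have [Sl|nSl] := boolP (S l); last first.
  have -> : a' = a.
    rewrite /a' /a /uletter /join_vars.
    by case: insubP => // k Sl; case/negP: nSl.
  rewrite add0n.
  have -> : a * W' - v ^+ n * (a * W) =
      a * (W' - v ^+ n * W) - commut (v ^+ n) a * W.
    by rewrite /commut; ncring.
  by apply: ler_nrmBD aK _; exact: ca'.
rewrite add1n.
have -> : a' = if l.2 then a * v else v * a.
  rewrite /a' /a /uletter /join_vars.
  case: insubP => [k _ _|/negP[] //].
  by case: l.2; rewrite // adjM va.
case: l.2.
  have -> : a * v * W' - v ^+ n.+1 * (a * W) =
      a * (v * (W' - v ^+ n * W)) - commut (v ^+ n.+1) a * W.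
    by rewrite /commut exprS; ncring.
  apply: ler_nrmBD; last exact: ca'.
  by rewrite -mulrA ler_nrmMM // -[K * e]mul1r ler_nrmMM.
have -> : v * a * W' - v ^+ n.+1 * (a * W) =
    v * (a * (W' - v ^+ n * W) - commut (v ^+ n) a * W).
  by rewrite /commut exprS; ncring.
rewrite -[leRHS]mul1r; apply: ler_nrmMM => //.
by apply: ler_nrmBD aK _; exact: ca'.
Qed.

Lemma homogeneous_sum (T : eqType) d (s : seq T) (c : T -> R[i])
    (f : T -> ('I_r -> B) -> B) :
  (forall m, m \in s -> quasi_homogeneous d (f m)) ->
  quasi_homogeneous d (fun X => \sum_(m <- s) c m *: f m X).
Proof.
move=> hf X; elim: s hf => [|m s IH] hf.
  exists [::], 0 => // v e _ _ _ _.
  by rewrite !big_nil mulr0 subrr nrm0 mul0r.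
have [m' ms|F [K K0 hK]] := IH; first by apply: hf; rewrite inE ms orbT.
have [|F' [K' K'0 hK']] := hf m _ X; first by rewrite inE eqxx.
have c0 : 0 <= complex.Re `|c m|.
  by rewrite normc_def /= sqrtr_ge0.
exists (F' ++ F), (complex.Re `|c m| * K' + K); first by rewrite addr_ge0 ?mulr_ge0.
move=> v e va v1 hF e0.
have h : nrm (\sum_(i <- s) c i *: f i (fun k => v * X k) -
    v ^+ d * \sum_(i <- s) c i *: f i X) <= K * e.
  by apply: hK => // b bF; apply: hF; rewrite mem_cat bF orbT.
have h' : nrm (f m (fun k => v * X k) - v ^+ d * f m X) <= K' * e.
  by apply: hK' => // b bF; apply: hF; rewrite mem_cat bF.
rewrite !big_cons mulrDr opprD addrACA -scalerAr -scalerBr mulrDl.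
apply: ler_nrmDD => //.
by rewrite nrmZ -mulrA ler_wpM2l.
Qed.

Lemma ueval_homogeneous d p : homogeneous_in (fun n => (n < r)%N) d p ->
  quasi_homogeneous d (fun X => ueval (join_vars X y) p).
Proof.
move=> hp; apply: homogeneous_sum => m /hp <-.
exact: uword_homogeneous.
Qed.

Lemma ueval_compatible p : ideal_compatible I (fun X => ueval (join_vars X y) p).
Proof.
move=> X Y XY; rewrite /ueval -sumrB; apply: uc_sum => m _.
rewrite -scalerBr; apply: ucZ; rewrite /uword.
elim: (monalg.fmonom_val m) => [|l w IH]; first by rewrite !big_nil subrr; exact: uc0.
rewrite !big_cons.
have -> : forall a a' b b' : B, a * b - a' * b' = (a - a') * b + a' * (b - b').
  by move=> *; ncring.
apply: ucD; last exact: ucMl.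
apply: ucMr; rewrite /uletter /join_vars.
case: insubP => [k _ _|_]; last by rewrite subrr; exact: uc0.
by case: l.2; rewrite // -adjB; exact: uc_adj.
Qed.

End PolynomialFunctions.

(** * Norms of complex numbers and completeness *)

Lemma cauchy_limit (K : numFieldType) (V : completeNormedModType K)
    (u : nat -> V) :
  (forall e : K, 0 < e -> exists N, forall m n, (N <= m)%N -> (N <= n)%N ->
     `|u m - u n| < e) ->
  exists l, forall e : K, 0 < e -> exists N, forall n, (N <= n)%N ->
     `|u n - l| <= e.
Proof.
move=> hu.
have ex : cauchy_ex (u @ \oo)%classic.
  move=> e /hu[N hN]; exists (u N); exists N => // n /= Nn.
  by rewrite -ball_normE /=; exact: hN.
have cu : (cvg (u @ \oo))%classic by apply: cauchy_cvg; exact: cauchy_exP.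
exists (lim (u @ \oo)%classic) => e e0.
have /cvgrPdist_le /(_ e e0) [N _ hN] := cu.
by exists N => n Nn; rewrite distrC; exact: hN.
Qed.

Section ComplexNorm.
Variable R : realType.
Implicit Types (z : R[i]).

Lemma Re_norm_ge0 z : 0 <= complex.Re `|z|.
Proof. by rewrite normc_def /= sqrtr_ge0. Qed.

Lemma Re_normK z : (complex.Re `|z|)%:C = `|z|.
Proof. by apply: RRe_real; exact: normr_real. Qed.

Lemma Re_norm0 : complex.Re `|0 : R[i]| = 0.
Proof. by rewrite normr0. Qed.

Lemma Re_norm1 : complex.Re `|1 : R[i]| = 1.
Proof. by rewrite normr1. Qed.

Lemma Re_normM z w : complex.Re `|z * w| = complex.Re `|z| * complex.Re `|w|.
Proof.
have : (complex.Re `|z * w|)%:C = (complex.Re `|z| * complex.Re `|w|)%:C.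
  by rewrite rmorphM /= !Re_normK normrM.
by case.
Qed.

Lemma Re_normD z w : complex.Re `|z + w| <= complex.Re `|z| + complex.Re `|w|.
Proof. by rewrite -lecR rmorphD /= !Re_normK ler_normD. Qed.

Lemma Re_norm_eq0 z : complex.Re `|z| = 0 -> z = 0.
Proof.
by move=> h; apply/eqP; rewrite -normr_eq0 -Re_normK h.
Qed.

Lemma Re_norm_conj z : complex.Re `|conjc z| = complex.Re `|z|.
Proof. by case: z => a b; rewrite !normc_def /= sqrrN. Qed.

Lemma normc_le_ReIm z :
  complex.Re `|z| <= `|complex.Re z| + `|complex.Im z|.
Proof.
case: z => a b; rewrite normc_def /=.
rewrite -[leRHS]ger0_norm ?addr_ge0 // -sqrtr_sqr ler_wsqrtr // sqrrD.
rewrite !real_normK ?num_real // lerD2r lerDl mulrn_wge0 //.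
by rewrite mulr_ge0.
Qed.

Lemma abs_Im_le z : `|complex.Im z| <= complex.Re `|z|.
Proof.
case: z => a b; rewrite normc_def /= -sqrtr_sqr ler_wsqrtr //.
by rewrite lerDr sqr_ge0.
Qed.

Lemma abs_Re_le z : `|complex.Re z| <= complex.Re `|z|.
Proof. by rewrite -lecR Re_normK normc_ge_Re. Qed.

Lemma complex_cauchy_limit (u : nat -> R[i]) :
  (forall e, 0 < e -> exists N, forall m n, (N <= m)%N -> (N <= n)%N ->
     complex.Re `|u m - u n| <= e) ->
  exists l, forall e, 0 < e -> exists N, forall n, (N <= n)%N ->
     complex.Re `|u n - l| <= e.
Proof.
move=> hu.
have part (f : R[i] -> R) : (forall z, `|f z| <= complex.Re `|z|) ->
    (forall z w, f (z - w) = f z - f w) ->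
    exists l, forall e, 0 < e -> exists N, forall n, (N <= n)%N ->
      `|f (u n) - l| <= e.
  move=> fle fB; apply: (@cauchy_limit R R) => e e0.
  have [N hN] := hu (e / 2) (divr_gt0 e0 (ltr0Sn _ 1)).
  exists N => m n Nm Nn; rewrite -fB.
  apply: le_lt_trans (fle _) _; apply: le_lt_trans (hN m n Nm Nn) _.
  by rewrite gtr_pMr // invf_lt1 ?ltr1n.
have [a ha] := part _ abs_Re_le (fun z w => raddfB _ z w).
have [b hb] := part _ abs_Im_le (fun z w => raddfB _ z w).
exists (a +i* b) => e e0; have e2 : 0 < e / 2 by rewrite divr_gt0.
have [N hN] := ha _ e2; have [N' hN'] := hb _ e2.
exists (maxn N N') => n; rewrite geq_max => /andP[Nn N'n].
apply: le_trans (normc_le_ReIm _) _; rewrite [e]splitr lerD //.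
  by rewrite raddfB; exact: hN.
by rewrite raddfB; exact: hN'.
Qed.

End ComplexNorm.

Section CNorm.
Variables (R : realType) (A : cstarAlgType R).
Implicit Types (a b : A) (z : R[i]).

Lemma cnormK a : (cnorm a)%:C = `|a|.
Proof. by apply: RRe_real; exact: normr_real. Qed.

Lemma cnorm_ge0 a : 0 <= cnorm a.
Proof. by rewrite -lecR cnormK normr_ge0. Qed.

Lemma cnorm_eq0 a : cnorm a = 0 -> a = 0.
Proof. by move=> h; apply/eqP; rewrite -normr_eq0 -cnormK h. Qed.

Lemma cnormD a b : cnorm (a + b) <= cnorm a + cnorm b.
Proof. by rewrite -lecR rmorphD /= !cnormK ler_normD. Qed.

Lemma cnormZ z a : cnorm (z *: a) = complex.Re `|z| * cnorm a.
Proof.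
have : (cnorm (z *: a))%:C = (complex.Re `|z| * cnorm a)%:C.
  by rewrite rmorphM /= !cnormK Re_normK normrZ.
by case.
Qed.

Lemma cnormM a b : cnorm (a ** b) <= cnorm a * cnorm b.
Proof. by rewrite -lecR rmorphM /= !cnormK amul_norm. Qed.

Lemma cnorm0 : cnorm (0 : A) = 0.
Proof. by rewrite /cnorm normr0. Qed.

Lemma cnorm_cstar a : cnorm (star a ** a) = cnorm a ^+ 2.
Proof.
have : (cnorm (star a ** a))%:C = (cnorm a ^+ 2)%:C.
  by rewrite rmorphXn /= !cnormK cstar_norm.
by case.
Qed.

Lemma amul0r a : 0 ** a = 0.
Proof. by rewrite -[0 in LHS](scale0r (0 : A)) amulZl scale0r. Qed.

Lemma amulr0 a : a ** 0 = 0.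
Proof. by rewrite -[0 in LHS](scale0r (0 : A)) amulZr scale0r. Qed.

Lemma cnorm_star a : cnorm (star a) = cnorm a.
Proof.
suff le b : cnorm b <= cnorm (star b).
  by apply/le_anti; rewrite le andbT -{2}(starK a) le.
have := cnormM (star b) b; rewrite cnorm_cstar expr2.
have := cnorm_ge0 b; rewrite le0r => /orP[/eqP ->|b0]; first by rewrite cnorm_ge0.
by rewrite ler_pM2r.
Qed.

Lemma cnorm_cauchy_limit (u : nat -> A) :
  (forall e, 0 < e -> exists N, forall m n, (N <= m)%N -> (N <= n)%N ->
     cnorm (u m - u n) <= e) ->
  exists l, forall e, 0 < e -> exists N, forall n, (N <= n)%N ->
     cnorm (u n - l) <= e.
Proof.
move=> hu.
have [e e0|l hl] := @cauchy_limit _ A u.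
  have eE : (complex.Re e)%:C = e by apply: RRe_real; exact: gtr0_real.
  have e0' : 0 < complex.Re e by rewrite -ltcR eE.
  have [N hN] := hu (complex.Re e / 2) (divr_gt0 e0' (ltr0Sn _ 1)).
  exists N => m n Nm Nn; rewrite -cnormK -eE ltcR.
  apply: le_lt_trans (hN m n Nm Nn) _.
  by rewrite gtr_pMr // invf_lt1 ?ltr1n.
exists l => e e0; have [|N hN] := hl e%:C; first by rewrite ltcR.
by exists N => n /hN; rewrite -cnormK lecR.
Qed.

End CNorm.

(** * The unitization *)

(** Scalars form the second component. The module [R[i]^o] makes the pairs a
    complex vector space. *)
Definition unitization (R : realType) (A : cstarAlgType R) : Type :=
  (A * R[i]^o)%type.

Section Unitization.
Variables (R : realType) (A : cstarAlgType R).
Local Notation U := (unitization A).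
Implicit Types (x y z : U) (a b : A) (M : R).

HB.instance Definition _ := GRing.Lmodule.copy U (A * R[i]^o)%type.

Definition uone : U := (0, 1).

Definition umul x y : U :=
  (x.1 ** y.1 + x.2 *: y.1 + y.2 *: x.1, x.2 * y.2).

Definition uadj x : U := (star x.1, conjc x.2).

Lemma umulA : associative umul.
Proof.
move=> [x s] [y t] [z u]; rewrite /umul /=; congr (_, _); last exact: mulrA.
rewrite !amulDr !amulDl !amulZl !amulZr !scalerDr !scalerA amulA.
rewrite [u * s]mulrC [u * t]mulrC !addrA.
by rewrite [LHS](ACl (1*4*2*5*3*6*7))%AC.
Qed.

Lemma umul1x : left_id uone umul.
Proof.
move=> [x s]; rewrite /umul /= amul0r add0r scale1r scaler0 addr0.
by rewrite mul1r.
Qed.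

Lemma umulx1 : right_id uone umul.
Proof.
move=> [x s]; rewrite /umul /= amulr0 add0r scale1r scaler0 add0r.
by rewrite mulr1.
Qed.

Lemma umulDl : left_distributive umul +%R.
Proof.
move=> [x s] [y t] [z u]; rewrite /umul /=; congr (_, _); last exact: mulrDl.
rewrite amulDl scalerDl scalerDr !addrA.
by rewrite [LHS](ACl (1*3*5*2*4*6))%AC.
Qed.

Lemma umulDr : right_distributive umul +%R.
Proof.
move=> [x s] [y t] [z u]; rewrite /umul /=; congr (_, _); last exact: mulrDr.
rewrite amulDr scalerDl scalerDr !addrA.
by rewrite [LHS](ACl (1*3*5*2*4*6))%AC.
Qed.

Lemma uone_neq0 : uone != 0.
Proof. by apply/eqP; case=> /eqP; rewrite oner_eq0. Qed.

HB.instance Definition _ := GRing.Zmodule_isNzRing.Build U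
  umulA umul1x umulx1 umulDl umulDr uone_neq0.

Lemma uscaleAl (k : R[i]) x y : k *: (x * y) = (k *: x) * y.
Proof.
case: x y => [x s] [y t]; congr (_, _); last exact: mulrA.
by rewrite /= !scalerDr amulZl !scalerA [t * k]mulrC.
Qed.

HB.instance Definition _ :=
  GRing.LSemiModule_isLSemiAlgebra.Build R[i] U uscaleAl.

Lemma uscaleAr (k : R[i]) x y : k *: (x * y) = x * (k *: y).
Proof.
case: x y => [x s] [y t]; congr (_, _); last exact: mulrCA.
by rewrite /= !scalerDr amulZr !scalerA [s * k]mulrC.
Qed.

HB.instance Definition _ :=
  GRing.LSemiAlgebra_isSemiAlgebra.Build R[i] U uscaleAr.

Definition uact x b : A := x.1 ** b + x.2 *: b.

Lemma uactM x y b : uact (x * y) b = uact x (uact y b).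
Proof.
rewrite /uact /= !amulDl !amulDr !amulZl !amulZr !scalerDr scalerA amulA.
by rewrite -!addrA; congr (_ + _); rewrite addrCA.
Qed.

Lemma uactD x y b : uact (x + y) b = uact x b + uact y b.
Proof. by rewrite /uact /= amulDl scalerDl addrACA. Qed.

Lemma uactZ (k : R[i]) x b : uact (k *: x) b = k *: uact x b.
Proof. by rewrite /uact /= amulZl scalerDr scalerA. Qed.

Lemma uactZr (k : R[i]) x b : uact x (k *: b) = k *: uact x b.
Proof. by rewrite /uact amulZr scalerDr !scalerA mulrC. Qed.

Lemma uact_adj x b : star (uact x b) = star b ** star x.1 + conjc x.2 *: star b.
Proof. by rewrite /uact starD starM starZ. Qed.

Definition uact_norms x : set R :=
  [set cnorm (uact x b) | b in [set b | cnorm b <= 1]]%classic.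

(** The operator norm of left multiplication alone would vanish on [1 - e] if
    [A] had a unit [e]; the maximum with the modulus of the scalar part keeps
    it a norm, and still a C-star-norm. *)
Definition unrm x : R := Num.max (reals.sup (uact_norms x)) (complex.Re `|x.2|).

Lemma cnorm_uact_le x b :
  cnorm (uact x b) <= (cnorm x.1 + complex.Re `|x.2|) * cnorm b.
Proof.
rewrite mulrDl; apply: le_trans (cnormD _ _) _.
by rewrite lerD ?cnormM // cnormZ.
Qed.

Lemma uact_norms_bounded x : has_ubound (uact_norms x).
Proof.
exists (cnorm x.1 + complex.Re `|x.2|) => _ [b /= b1 <-].
apply: le_trans (cnorm_uact_le _ _) _.
by rewrite ler_piMr // addr_ge0 ?cnorm_ge0 ?Re_norm_ge0.
Qed.

Lemma unrm_ge0 x : 0 <= unrm x.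
Proof. by rewrite le_max Re_norm_ge0 orbT. Qed.

Lemma unrm_act x b : cnorm (uact x b) <= unrm x * cnorm b.
Proof.
have [b0|b0] := eqVneq (cnorm b) 0.
  by rewrite (cnorm_eq0 b0) /uact amulr0 scaler0 addr0 !cnorm0 mulr0.
have bp : 0 < cnorm b by rewrite lt_def b0 cnorm_ge0.
have bE : b = (cnorm b)%:C *: ((cnorm b)^-1%:C *: b).
  by rewrite scalerA -rmorphM /= divff // scale1r.
rewrite {1}bE uactZr cnormZ Re_norm_real ger0_norm ?cnorm_ge0 // mulrC.
rewrite ler_pM2r // le_max; apply/orP; left.
apply: ub_le_sup; first exact: uact_norms_bounded.
exists ((cnorm b)^-1%:C *: b) => //=.
rewrite cnormZ Re_norm_real ger0_norm ?invr_ge0 ?cnorm_ge0 // mulVf //.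
Qed.

Lemma unrm_snd x : complex.Re `|x.2| <= unrm x.
Proof. by rewrite le_max lexx orbT. Qed.

Lemma unrm_le x M : 0 <= M -> complex.Re `|x.2| <= M ->
  (forall b, cnorm (uact x b) <= M * cnorm b) -> unrm x <= M.
Proof.
move=> M0 xM h; rewrite ge_max xM andbT; apply: ge_sup.
  by exists (cnorm (uact x 0)), 0 => //=; rewrite cnorm0.
move=> _ [b /= b1 <-]; apply: le_trans (h b) _.
by rewrite ler_piMr.
Qed.

Lemma unrm0_eq0 x : unrm x = 0 -> x = 0.
Proof.
move=> x0; have x2 : x.2 = 0.
  by apply: Re_norm_eq0; apply/le_anti; rewrite Re_norm_ge0 -x0 unrm_snd.
have : x.1 = 0.
  have := unrm_act x (star x.1); rewrite x0 mul0r /uact x2 scale0r addr0.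
  rewrite -[X in X ** _]starK cnorm_cstar => h.
  apply: cnorm_eq0; rewrite -cnorm_star; apply/eqP.
  by rewrite -sqrf_eq0; apply/eqP/le_anti; rewrite h exprn_ge0 ?cnorm_ge0.
by case: x x2 {x0} => [x s] /= -> ->.
Qed.

Lemma unrmD x y : unrm (x + y) <= unrm x + unrm y.
Proof.
apply: unrm_le => [||b]; first by rewrite addr_ge0 ?unrm_ge0.
  by apply: le_trans (Re_normD _ _) _; rewrite lerD ?unrm_snd.
rewrite uactD mulrDl; apply: le_trans (cnormD _ _) _.
by rewrite lerD ?unrm_act.
Qed.

Lemma unrmM x y : unrm (x * y) <= unrm x * unrm y.
Proof.
apply: unrm_le => [||b]; first by rewrite mulr_ge0 ?unrm_ge0.
  rewrite -[leLHS]/(complex.Re `|(x.2 : R[i]) * y.2|) Re_normM.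
  by rewrite ler_pM ?Re_norm_ge0 ?unrm_snd.
rewrite uactM -mulrA; apply: le_trans (unrm_act _ _) _.
by rewrite ler_wpM2l ?unrm_ge0 ?unrm_act.
Qed.

Lemma unrmZ (k : R[i]) x : unrm (k *: x) = complex.Re `|k| * unrm x.
Proof.
have le (l : R[i]) y : unrm (l *: y) <= complex.Re `|l| * unrm y.
  apply: unrm_le => [||b]; first by rewrite mulr_ge0 ?unrm_ge0 ?Re_norm_ge0.
    rewrite -[leLHS]/(complex.Re `|(l : R[i]) * y.2|) Re_normM.
    by rewrite ler_wpM2l ?Re_norm_ge0 ?unrm_snd.
  by rewrite uactZ cnormZ -mulrA ler_wpM2l ?Re_norm_ge0 ?unrm_act.
apply/le_anti/andP; split; first exact: le.
have [->|k0] := eqVneq k 0.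
  by rewrite Re_norm0 mul0r unrm_ge0.
have kp : 0 < complex.Re `|k|.
  rewrite lt_def Re_norm_ge0 andbT; apply: contra k0 => /eqP h.
  by rewrite (Re_norm_eq0 h).
rewrite -ler_pdivlMl //; have := le k^-1 (k *: x).
rewrite scalerA mulVf // scale1r.
suff -> : complex.Re `|k^-1| = (complex.Re `|k|)^-1 by [].
apply: (@mulfI _ (complex.Re `|k|)); first by rewrite gt_eqF.
by rewrite divff ?gt_eqF // -Re_normM divff // normr1.
Qed.

Lemma uadjD x y : uadj (x + y) = uadj x + uadj y.
Proof. by rewrite /uadj /= starD rmorphD. Qed.

Lemma uadjZ (k : R[i]) x : uadj (k *: x) = conjc k *: uadj x.
Proof. by congr (_, _); rewrite /= ?starZ ?rmorphM. Qed.

Lemma uadjM x y : uadj (x * y) = uadj y * uadj x.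
Proof.
congr (_, _); rewrite /= ?rmorphM 1?mulrC //.
by rewrite !starD starM !starZ addrAC.
Qed.

Lemma uadjK x : uadj (uadj x) = x.
Proof. by case: x => x s; rewrite /uadj /= starK conjcK. Qed.

Lemma unrm_cstar_le x : unrm x ^+ 2 <= unrm (uadj x * x).
Proof.
have N0 := unrm_ge0 (uadj x * x); set N := unrm _ in N0 *.
rewrite -[leRHS]sqr_sqrtr // ler_pXn2r ?nnegrE ?unrm_ge0 ?sqrtr_ge0 //.
apply: unrm_le => [||b]; first exact: sqrtr_ge0.
  rewrite -(@ler_pXn2r _ 2) ?nnegrE ?Re_norm_ge0 ?sqrtr_ge0 // sqr_sqrtr //.
  have := unrm_snd (uadj x * x).
  rewrite -[leLHS]/(complex.Re `|(conjc x.2 : R[i]) * x.2|).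
  by rewrite Re_normM Re_norm_conj -expr2.
rewrite -(@ler_pXn2r _ 2) ?nnegrE ?mulr_ge0 ?cnorm_ge0 ?sqrtr_ge0 //.
rewrite exprMn sqr_sqrtr // -cnorm_cstar.
have -> : star (uact x b) ** uact x b = star b ** uact (uadj x * x) b.
  rewrite uactM uact_adj; move: (uact x b) => w.
  by rewrite /uact /= amulDl amulDr amulA amulZl amulZr.
apply: le_trans (cnormM _ _) _; rewrite cnorm_star expr2 mulrA mulrC.
by rewrite ler_wpM2r ?cnorm_ge0 ?unrm_act.
Qed.

Definition uembed a : U := (a, 0).

Lemma uembedM a b : uembed (a ** b) = uembed a * uembed b.
Proof. by congr (_, _); rewrite /= ?scale0r ?addr0 ?mulr0. Qed.

Lemma unrm_embed a : unrm (uembed a) = cnorm a.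
Proof.
apply/le_anti/andP; split.
  apply: unrm_le => [||b]; first exact: cnorm_ge0.
    by rewrite -[leLHS]/(complex.Re `|0 : R[i]|) Re_norm0 cnorm_ge0.
  by rewrite /uact /= scale0r addr0 cnormM.
have := unrm_act (uembed a) (star a).
rewrite /uact /= scale0r addr0 -[X in X ** _]starK cnorm_cstar cnorm_star expr2.
have := cnorm_ge0 a; rewrite le0r => /orP[/eqP ->|a0]; first by rewrite unrm_ge0.
by rewrite ler_pM2r.
Qed.

Lemma unrm_complete (u : nat -> U) :
  (forall e, 0 < e -> exists N, forall m n, (N <= m)%N -> (N <= n)%N ->
     unrm (u m - u n) <= e) ->
  exists l, forall e, 0 < e -> exists N, forall n, (N <= n)%N ->
     unrm (u n - l) <= e.
Proof.
move=> hu.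
have [e e0|s hs] := @complex_cauchy_limit R (fun n => (u n).2).
  have [N hN] := hu e e0; exists N => m n Nm Nn.
  by apply: le_trans (hN m n Nm Nn); exact: (unrm_snd (u m - u n)).
have split2 (v w : U) : unrm (v - w) <= cnorm (v.1 - w.1) + complex.Re `|v.2 - w.2|.
  apply: unrm_le; first by rewrite addr_ge0 ?cnorm_ge0 ?Re_norm_ge0.
    by rewrite /= lerDr cnorm_ge0.
  by move=> b; exact: (cnorm_uact_le (v - w)).
have fst_le (v w : U) : cnorm (v.1 - w.1) <= unrm (v - w) + complex.Re `|v.2 - w.2|.
  have -> : cnorm (v.1 - w.1) = unrm ((v - w) + (- (v.2 - w.2)) *: (1 : U)).
    rewrite -unrm_embed; congr unrm; congr (_, _) => /=.
      by rewrite scaler0 addr0.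
    by rewrite [X in _ = _ + X]mulr1 subrr.
  apply: le_trans (unrmD _ _) _; rewrite lerD2l unrmZ normrN.
  rewrite -[leRHS]mulr1; apply: ler_wpM2l; first exact: Re_norm_ge0.
  apply: unrm_le => // [|b].
    by rewrite -[leLHS]/(complex.Re `|1 : R[i]|) Re_norm1.
  by rewrite /uact /= amul0r add0r scale1r mul1r.
have [e e0|a ha] := @cnorm_cauchy_limit R A (fun n => (u n).1).
  have e2 : 0 < e / 2 by rewrite divr_gt0.
  have [N hN] := hu _ e2; exists N => m n Nm Nn.
  apply: le_trans (fst_le _ _) _; rewrite [e]splitr lerD ?hN //.
  by apply: le_trans (hN m n Nm Nn); exact: (unrm_snd (u m - u n)).
exists (a, s) => e e0; have e2 : 0 < e / 2 by rewrite divr_gt0.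
have [N hN] := ha _ e2; have [N' hN'] := hs _ e2.
exists (maxn N N') => n; rewrite geq_max => /andP[Nn N'n].
apply: le_trans (split2 _ _) _; rewrite [e]splitr lerD //=.
  exact: hN.
exact: hN'.
Qed.

HB.instance Definition _ := isUnitalCStar.Build R U uadjD uadjZ uadjM uadjK
  unrm0_eq0 unrmD unrmZ unrmM unrm_cstar_le unrm_complete.

Variable I : closedIdeal A.

Definition uideal_set (x : U) : Prop := x.2 = 0 /\ ideal_set I x.1.

Lemma uideal_closed x :
  (forall e, 0 < e -> exists2 b, uideal_set b & nrm (x - b) <= e) ->
  uideal_set x.
Proof.
move=> h.
have x2 : x.2 = 0.
  apply: Re_norm_eq0; apply/le_anti; rewrite Re_norm_ge0 andbT.
  apply/ler_addgt0Pl => e /h[b [b2 _] hb]; rewrite addr0.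
  by apply: le_trans hb; have := unrm_snd (x - b); rewrite /= b2 subr0.
split=> //; have /closure_id -> := @ideal_closed R A I.
move=> V /nbhs_ballP[e e0 hV].
have eE : (complex.Re e)%:C = e by apply: RRe_real; exact: gtr0_real.
have e0' : 0 < complex.Re e by rewrite -ltcR eE.
have [b [b2 Ib] hb] := h (complex.Re e / 2) (divr_gt0 e0' (ltr0Sn _ 1)).
exists b.1; split=> //; apply: hV; rewrite -ball_normE /=.
rewrite -cnormK -eE ltcR -unrm_embed.
have -> : uembed (x.1 - b.1) = x - b.
  by congr (_, _); rewrite /= x2 b2 subrr.
by apply: le_lt_trans hb _; rewrite gtr_pMr // invf_lt1 ?ltr1n.
Qed.

Lemma uideal0 : uideal_set 0.
Proof. by split=> //; exact: ideal0. Qed.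

Lemma uidealD x y : uideal_set x -> uideal_set y -> uideal_set (x + y).
Proof.
move=> [x2 Ix] [y2 Iy]; split; first by rewrite /= x2 y2 addr0.
exact: idealD.
Qed.

Lemma uidealZ (k : R[i]) x : uideal_set x -> uideal_set (k *: x).
Proof.
move=> [x2 Ix]; split; last exact: idealZ.
by rewrite /= x2; exact: mulr0.
Qed.

Lemma uidealMl x y : uideal_set y -> uideal_set (x * y).
Proof.
move=> [y2 Iy]; split; first by rewrite /= y2 mulr0.
rewrite /= y2 scale0r addr0; apply: idealD; first exact: idealMl.
exact: idealZ.
Qed.

Lemma uidealMr x y : uideal_set x -> uideal_set (x * y).
Proof.
move=> [x2 Ix]; split; first by rewrite /= x2 mul0r.
rewrite /= x2 scale0r addr0; apply: idealD; first exact: Defs.idealMr.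
exact: idealZ.
Qed.

Definition uideal : ucideal U :=
  UCIdeal uideal0 uidealD uidealZ uidealMl uidealMr uideal_closed.

End Unitization.

(** * Passage to the unitization and the theorem *)

Section Transfer.
Variables (R : realType) (A : cstarAlgType R) (I : closedIdeal A) (r : nat).
Implicit Types (x : 'I_r -> A) (y : nat -> A) (a : A) (p : ncPoly R).

Lemma join_vars_comp (B B' : Type) (f : B -> B') (x : 'I_r -> B) (y : nat -> B) n :
  join_vars (fun k => f (x k)) (fun i => f (y i)) n = f (join_vars x y n).
Proof. by rewrite /join_vars; case: insub. Qed.

Lemma uembed_letter x y l :
  uletter (join_vars (fun k => uembed (x k)) (fun i => uembed (y i))) l =
  uembed (eval_letter (join_vars x y) l).
Proof.
rewrite /uletter /eval_letter !join_vars_comp; case: l.2 => //.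
by congr (_, _); exact: conjc0.
Qed.

Lemma uembed_word x y w : w != [::] ->
  uword (join_vars (fun k => uembed (x k)) (fun i => uembed (y i))) w =
  uembed (eval_word (join_vars x y) w).
Proof.
elim: w => // l [|l' w] IH _; rewrite /uword big_cons uembed_letter.
  by rewrite big_nil mulr1.
by rewrite -/(uword _ _) IH // -uembedM.
Qed.

(** The empty word has to be excluded: its value is [1] in the unitization and
    [0] in [A]. *)
Lemma ueval_embed x y p :
  (forall m : ncMonomial, m \in monalg.msupp p -> monalg.fmonom_val m != [::]) ->
  ueval (join_vars (fun k => uembed (x k)) (fun i => uembed (y i))) p =
  uembed (nceval (join_vars x y) p).
Proof.
move=> hp; rewrite /ueval /nceval.
have uD : {morph @uembed R A : a b / a + b}.
  by move=> a b; congr (_, _); rewrite /= ?addr0.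
rewrite (big_morph _ uD (erefl : uembed (0 : A) = 0)).
apply: eq_big_seq => m mp; rewrite uembed_word; last exact: hp.
by congr (_, _); exact: mulr0.
Qed.

Lemma ideal_star a : ideal_set I a -> ideal_set I (star a).
Proof.
move=> Ia; have h : uideal I (uembed a) by [].
by have [_] := uc_adj h.
Qed.

Lemma cproj_star a : cproj I (star a) = star (cproj I a).
Proof.
apply/cprojP; set b := repr _.
have -> : star a - star b = star (a - b).
  by rewrite starD -[- b]scaleN1r starZ rmorphN rmorph1 scaleN1r.
by apply/ideal_star/cprojP; rewrite cproj_repr.
Qed.

Lemma cproj0 : cproj I 0 = 0.
Proof. by apply: (addrI (cproj I 0)); rewrite -cprojD !addr0. Qed.

Lemma cproj_word x y w :
  eval_word (join_vars (fun k => cproj I (x k)) (fun i => cproj I (y i))) w =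
  cproj I (eval_word (join_vars x y) w).
Proof.
have letter l : eval_letter
    (join_vars (fun k => cproj I (x k)) (fun i => cproj I (y i))) l =
    cproj I (eval_letter (join_vars x y) l).
  by rewrite /eval_letter !join_vars_comp; case: l.2 => //; rewrite cproj_star.
elim: w => [|l [|l' w] IH]; [by rewrite cproj0 | exact: letter |].
by rewrite -[LHS]/(eval_letter _ l ** eval_word _ (l' :: w)) IH letter -cprojM.
Qed.

Lemma cproj_nceval x y p :
  nceval (join_vars (fun k => cproj I (x k)) (fun i => cproj I (y i))) p =
  cproj I (nceval (join_vars x y) p).
Proof.
rewrite /nceval (big_morph (cproj I) (@cprojD _ _ I) cproj0).
by apply: eq_bigr => m _; rewrite cproj_word cprojZ.
Qed.

Lemma qnorm_lift (q : cquot I) (M e : R) : qnorm q <= M -> 0 < e ->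
  exists2 a, cproj I a = q & cnorm a <= M + e.
Proof.
move=> qM e0.
have [|_ [a /= aq <-] ha] := @inf_adherent R
    [set cnorm a | a in [set a | cproj I a = q]]%classic e e0.
  split; first by exists (cnorm (repr q)), (repr q) => //=; exact: cproj_repr.
  by exists 0 => _ [a _ <-]; exact: cnorm_ge0.
by exists a => //; apply: le_trans (ltW ha) _; rewrite lerD2r.
Qed.

End Transfer.

Theorem theorem4p3 (R : realType) (r J : nat)
  (hr : (1 <= r)%N) (hJ : (1 <= J)%N)
  (p : 'I_J -> ncPoly R) (d : 'I_J -> nat)
  (hd : forall j, (1 <= d j)%N)
  (hp : forall j, homogeneous_in (fun n => (n < r)%N) (d j) (p j))
  (C : 'I_J -> R) (hC : forall j, 0 < C j)
  (A : cstarAlgType R) (I : closedIdeal A)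
  (x : 'I_r -> A) (y : nat -> A)
  (hx : forall k l, cproj I (x k) ** cproj I (x l) = 0)
  (hpx : forall j,
    qnorm (nceval
      (join_vars (fun k => cproj I (x k)) (fun i => cproj I (y i))) (p j))
    <= C j) :
  exists xbar : 'I_r -> A,
    [/\ forall k, cproj I (xbar k) = cproj I (x k),
        forall k l, xbar k ** xbar l = 0
      & forall j, cnorm (nceval (join_vars xbar y) (p j)) <= C j].
Proof.
pose x' k := uembed (x k); pose y' i := uembed (y i).
have words j (m : ncMonomial) :
    m \in monalg.msupp (p j) -> monalg.fmonom_val m != [::].
  move=> /(hp j); case: (monalg.fmonom_val m) => // h0.
  by have := hd j; rewrite -h0.
have xx k l : uideal I (x' k * x' l).
  rewrite -uembedM; split=> //=; rewrite -[_ ** _]subr0; apply/cprojP.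
  by rewrite cprojM hx cproj0.
have Px j e : 0 < e -> exists2 z, uideal I z &
    nrm (ueval (join_vars x' y') (p j) - z) <= C j + e.
  move=> e0; have [a aq ha] := qnorm_lift (hpx j) e0.
  pose b := nceval (join_vars x y) (p j).
  exists (uembed (b - a)).
    by split=> //=; apply/cprojP; rewrite aq cproj_nceval.
  rewrite (ueval_embed _ _ (words j)) -/b.
  have -> : uembed b - uembed (b - a) = uembed a.
    by congr (_, _); rewrite /= ?subKr ?subrr.
  by rewrite [nrm _]unrm_embed.
have [X [IX XX PX]] := nilpotent_lifting hd hC
  (fun j => @ueval_lipschitz R _ r y' (p j))
  (fun j => @ueval_homogeneous R _ r y' _ _ (hp j))
  (fun j => @ueval_compatible R _ (uideal I) r y' (p j)) xx Px.
pose xbar k := (X k).1.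
have XE k : X k = uembed (xbar k).
  have [h _] := IX k; move: h; rewrite /= subr0.
  by rewrite /xbar /uembed; case: (X k) => a s /= ->.
exists xbar; split=> [k|k l|j].
- by apply/cprojP; case: (IX k).
- by have := XX k l; rewrite !XE -uembedM; case.
- have := PX j; rewrite (_ : X = fun k => uembed (xbar k)); last exact/funext.
  by rewrite (ueval_embed _ _ (words j)) [nrm _]unrm_embed.
Qed.
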